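(* Let $(M_p)_{p\in\mathbb{N}}$ be a sequence of positive real numbers that is log-convex, i.e. $M_p^2\le M_{p-1}M_{p+1}$ for all $p\ge 1$, and such that $\lim_{p\to\infty} M_p/M_{p-1}=\infty$. Then: (Beurling case) the Gelfand-Shilov space $\mathcal{S}^{(p!)}_{(M_p)}$ is non-trivial if and only if $$\sup_{p\ge 2}\frac{(\log p)^p}{h^pM_p}<\infty\quad\text{for all } h>0;$$ (Roumieu case) the Gelfand-Shilov space $\mathcal{S}^{\{p!\}}_{\{M_p\}}$ is non-trivial if and only if $$\sup_{p\ge 2}\frac{(\log p)^p}{h^pM_p}<\infty\quad\text{for some } h>0.$$
   Context: A function space is non-trivial if it contains a function that is not identically zero. For $h>0$ put $T^h=\{z\in\mathbb{C}:|\operatorname{Im} z|<h\}$. The associated function of $(M_p)$ is $M(t)=\sup_{p\in\mathbb{N}}\log\left(\frac{t^pM_0}{M_p}\right)$ for $t>0$, and $M(0)=0$. The mixed type Gelfand-Shilov spaces are described as follows: - $\mathcal{S}^{(p!)}_{(M_p)}$ is the space of all entire functions $\varphi$ such that $\sup_{z\in T^h}|\varphi(z)|e^{M(\lambda|\operatorname{Re} z|)}<\infty$ for every $h>0$ and every $\lambda>0$. - $\mathcal{S}^{\{p!\}}_{\{M_p\}}$ is the space of all functions $\varphi$ that are analytic on $T^h$ and satisfy $\sup_{z\in T^h}|\varphi(z)|e^{M(\lambda|\operatorname{Re} z|)}<\infty$ for some $h>0$ and some $\lambda>0$ (depending on $\varphi$). *)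

(* Defs.v *)
From Stdlib Require Export Reals.
From Coquelicot Require Export Coquelicot.
Open Scope R_scope.

(* A function whose domain is part of the data: only its values on [dom] matter. *)
Record pfun : Type := Pfun { dom : C -> Prop; val : C -> C }.

Definition nontrivial (S : pfun -> Prop) : Prop :=
  exists f : pfun, S f /\ exists z : C, dom f z /\ val f z <> RtoC 0.

Definition strip (h : R) (z : C) : Prop := Rabs (Im z) < h.

(* For open [U]: shrinking the disc keeps it inside [U], so only the values of
   [f] on [U] matter. *)
Definition analytic_on (U : C -> Prop) (f : C -> C) : Prop :=
  forall z0 : C, U z0 ->
    exists (a : nat -> C) (r : R), 0 < r /\
      forall z : C, Cmod (z - z0)%C < r ->
        @is_pseries C_AbsRing (AbsRing_NormedModule C_AbsRing) a (z - z0)%C (f z).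

(* When [M p / M (p - 1)] tends to infinity the supremum is finite, so that
   [real] loses nothing. *)
Definition assoc_fun (M : nat -> R) (t : R) : R :=
  if Rlt_dec 0 t
  then real (Sup_seq (fun p : nat => Finite (ln (t ^ p * M 0%nat / M p))))
  else 0.

Definition decay_bound (M : nat -> R) (h lambda : R) (f : C -> C) : Prop :=
  bound (fun y : R => exists z : C, strip h z /\
    y = Cmod (f z) * exp (assoc_fun M (lambda * Rabs (Re z)))).

Definition GS_Beurling (M : nat -> R) (f : pfun) : Prop :=
  (forall z : C, dom f z) /\
  analytic_on (dom f) (val f) /\
  forall h lambda : R, 0 < h -> 0 < lambda -> decay_bound M h lambda (val f).

Definition GS_Roumieu (M : nat -> R) (f : pfun) : Prop :=
  exists h lambda : R, 0 < h /\ 0 < lambda /\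
    (forall z : C, dom f z <-> strip h z) /\
    analytic_on (dom f) (val f) /\
    decay_bound M h lambda (val f).

(* Main.v *)
Require Import Defs.
From Stdlib Require Import Reals.
From Coquelicot Require Import Coquelicot.
From Stdlib Require Import Factorial Lra Lia Classical IndefiniteDescription.
Open Scope R_scope.

(** Write m for the associated function of M. The growth conditions on M are bounds
    on m: if (log p)^p <= C h^p M_p for all p >= 2, then m(t) <= C' + 2 e^(h t)
    ([assoc_fun_upper]); conversely, if m(lambda x) <= K e^(mu x), then the condition
    holds with h = 2 e mu / lambda ([log_growth_of_assoc_fun]). The theorem thus
    says how fast a nonzero analytic function can decay on a strip: like
    exp(-e^(mu |x|)) for some mu, but not faster than exp(-K e^(mu |x|)) for every K on
    a strip wider than PI / mu.

    Necessity. Let f decay on the strip |Im z| < h and let f(z0) be nonzero. On a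
    rectangle |Im z| <= h', x1 <= Re z <= x around z0 multiply f by
    exp (a sinh (mu (z - x1))) with mu = PI / (2 h'). The real part of the exponent
    vanishes on three sides; on the side Re z = x it is at most m(lambda x) for a
    suitable a, and the decay of f absorbs it. The maximum modulus principle
    ([max_modulus_rect]) bounds the product at z0, which reads
    m(lambda x) <= K e^(mu x) ([assoc_fun_exp_bound]). Here mu depends on z0 and on the
    strip only. In the Beurling case lambda is still free, and a large lambda makes
    h = 2 e mu / lambda as small as desired.

    Sufficiency. The function is exp(-G) with the even entire function
    G(z) = sum_j (z / ((j + 1) N_j))^(2 j), for a sequence N_j >= 1. On |Im z| < h the
    terms with 6 j h <= |Re z| have a real part of at least half their size on the real
    axis, and the other ones are at most 2^(-j) as soon as N_j >= 14 h. So
    Re G(z) is at least half of any single main term, minus 2 ([Re_entire_ge]), and for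
    x = |Re z| the best term has size about e^(2 x / (3 N_j)) ([entire_term_growth]). In
    the Roumieu case N_j = 1 on a thin strip suffices. In the Beurling case N_j tends to
    infinity, which takes care of every strip and of every lambda, but so slowly that
    e^(2 x / (3 N_j)) still dominates m(N_j x); this is possible because m grows more
    slowly than every exponential ([assoc_fun_threshold], [slow_sequence]).

    Analytic means locally a power series, so both directions need products and
    exponentials of power series. They come from the Wiener algebra of a disc of radius
    r, the power series with finite norm sum_k |a_k| r^k: it is complete
    ([wiener_series]), and its stability under products and under the exponential
    follows from that. *)

(** * Series of complex numbers *)

(** The index [n] is included, as in [sum_f_R0]. *)
Fixpoint csum (u : nat -> C) (n : nat) : C :=
  match n with
  | O => u O
  | S k => (csum u k + u (S k))%C
  end.

Definition cseries (u : nat -> C) (l : C) : Prop :=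
  is_lim_seq (fun n => Cmod (csum u n - l)%C) 0.

Lemma is_lim_seq_0_le (u v : nat -> R) :
  (forall n, 0 <= u n <= v n) -> is_lim_seq v 0 -> is_lim_seq u 0.
Proof.
  intros H Hv. apply is_lim_seq_le_le with (u := fun _ => 0) (w := v); auto.
  apply is_lim_seq_const.
Qed.

Lemma is_lim_seq_0_eps (u : nat -> R) :
  (forall n, 0 <= u n) ->
  (is_lim_seq u 0 <->
   forall eps, 0 < eps -> exists N, forall n, (N <= n)%nat -> u n < eps).
Proof.
  intros Hu. split; intros H.
  - intros eps He. apply is_lim_seq_spec in H. destruct (H (mkposreal _ He)) as [N HN].
    exists N. intros n Hn. specialize (HN n Hn). simpl in HN.
    rewrite Rminus_0_r, Rabs_pos_eq in HN; auto.
  - apply is_lim_seq_spec. intros [eps He]. destruct (H eps He) as [N HN].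
    exists N. intros n Hn. simpl. rewrite Rminus_0_r, Rabs_pos_eq; auto.
Qed.

Lemma Cmod_sub_sym (x y : C) : Cmod (x - y)%C = Cmod (y - x)%C.
Proof. rewrite <- Cmod_opp. f_equal. ring. Qed.

Lemma Cmod_sub_triangle (x y z : C) : Cmod (x - z)%C <= Cmod (x - y)%C + Cmod (y - z)%C.
Proof. replace (x - z)%C with ((x - y) + (y - z))%C by ring. apply Cmod_triangle. Qed.

Lemma Cmod_le_sub (x y : C) : Cmod x <= Cmod y + Cmod (x - y)%C.
Proof. replace x with (y + (x - y))%C at 1 by ring. apply Cmod_triangle. Qed.

Lemma Cmod_pair_le x y : Cmod (x, y) <= Rabs x + Rabs y.
Proof.
  replace (x, y) with (RtoC x + Ci * RtoC y)%C
    by (unfold Cplus, Cmult, Ci, RtoC; simpl; f_equal; ring).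
  eapply Rle_trans; [apply Cmod_triangle|]. rewrite Cmod_mult, Cmod_Ci, !Cmod_R. lra.
Qed.

Lemma csum_ext u v n : (forall k, u k = v k) -> csum u n = csum v n.
Proof. intros H. induction n; simpl; rewrite ?IHn, ?H; reflexivity. Qed.

Lemma csum_minus u v n : csum (fun k => u k - v k)%C n = (csum u n - csum v n)%C.
Proof. induction n; simpl; [|rewrite IHn]; ring. Qed.

Lemma csum_scal c u n : csum (fun k => c * u k)%C n = (c * csum u n)%C.
Proof. induction n; simpl; [|rewrite IHn]; ring. Qed.

Lemma csum_incr u n : csum u (S n) = (u O + csum (fun k => u (S k)) n)%C.
Proof. induction n; simpl in *; [|rewrite IHn]; ring. Qed.

Lemma csum_switch (u : nat -> nat -> C) m n :
  csum (fun i => csum (u i) n) m = csum (fun j => csum (fun i => u i j) m) n.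
Proof.
  induction n; simpl.
  - apply csum_ext. reflexivity.
  - rewrite <- IHn. clear. induction m; simpl; [|rewrite IHm]; ring.
Qed.

Lemma Cmod_csum u n : Cmod (csum u n) <= sum_f_R0 (fun k => Cmod (u k)) n.
Proof.
  induction n; simpl; [lra|]. eapply Rle_trans; [apply Cmod_triangle|]. lra.
Qed.

Lemma cseries_eps u l :
  cseries u l <->
  forall eps, 0 < eps -> exists N, forall n, (N <= n)%nat -> Cmod (csum u n - l)%C < eps.
Proof. apply is_lim_seq_0_eps. intros; apply Cmod_ge_0. Qed.

Lemma cseries_ext u v l : (forall k, u k = v k) -> cseries u l -> cseries v l.
Proof.
  intros H. apply is_lim_seq_ext. intros n. rewrite (csum_ext u v n H). reflexivity.
Qed.

Lemma cseries_unique u l l' : cseries u l -> cseries u l' -> l = l'.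
Proof.
  intros H H'.
  assert (E : is_lim_seq (fun _ : nat => Cmod (l - l')%C) 0).
  { apply is_lim_seq_0_le with
      (v := fun n => Cmod (csum u n - l)%C + Cmod (csum u n - l')%C).
    - intros n. split; [apply Cmod_ge_0|].
      rewrite (Cmod_sub_sym (csum u n) l). apply Cmod_sub_triangle.
    - replace 0 with (0 + 0) by ring. apply is_lim_seq_plus'; assumption. }
  apply is_lim_seq_unique in E. rewrite Lim_seq_const in E. injection E. intros E'.
  apply Cmod_eq_0 in E'. replace l with ((l - l') + l')%C by ring. rewrite E'. ring.
Qed.

Lemma cseries_minus u v l l' :
  cseries u l -> cseries v l' -> cseries (fun k => u k - v k)%C (l - l')%C.
Proof.
  intros H H'.
  apply is_lim_seq_0_le with (v := fun n => Cmod (csum u n - l)%C + Cmod (csum v n - l')%C).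
  - intros n. split; [apply Cmod_ge_0|]. rewrite csum_minus.
    rewrite (Cmod_sub_sym (csum v n) l').
    replace (csum u n - csum v n - (l - l'))%C with ((csum u n - l) + (l' - csum v n))%C by ring.
    apply Cmod_triangle.
  - replace 0 with (0 + 0) by ring. apply is_lim_seq_plus'; assumption.
Qed.

Lemma cseries_scal c u l : cseries u l -> cseries (fun k => c * u k)%C (c * l)%C.
Proof.
  intros H. unfold cseries. apply is_lim_seq_ext with (fun n => Cmod c * Cmod (csum u n - l)%C).
  - intros n. rewrite csum_scal, <- Cmod_mult. f_equal. ring.
  - replace (Finite 0) with (Rbar_mult (Cmod c) 0) by (simpl; f_equal; ring).
    apply is_lim_seq_scal_l. exact H.
Qed.

Lemma cseries_incr u l : cseries u l <-> cseries (fun k => u (S k)) (l - u O)%C.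
Proof.
  unfold cseries. rewrite is_lim_seq_incr_1.
  split; apply is_lim_seq_ext; intros n; rewrite csum_incr; f_equal; ring.
Qed.

Lemma is_lim_seq_Cmod_csum u l : cseries u l -> is_lim_seq (fun n => Cmod (csum u n)) (Cmod l).
Proof.
  intros H. apply is_lim_seq_le_le with
    (u := fun n => Cmod l - Cmod (csum u n - l)%C) (w := fun n => Cmod l + Cmod (csum u n - l)%C).
  - intros n. pose proof (Cmod_le_sub (csum u n) l). pose proof (Cmod_le_sub l (csum u n)).
    rewrite (Cmod_sub_sym l) in H1. lra.
  - pose proof (is_lim_seq_minus' _ _ _ _ (is_lim_seq_const (Cmod l)) H) as E.
    rewrite Rminus_0_r in E. exact E.
  - pose proof (is_lim_seq_plus' _ _ _ _ (is_lim_seq_const (Cmod l)) H) as E.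
    rewrite Rplus_0_r in E. exact E.
Qed.

Lemma cseries_Cmod_le u l B : cseries u l -> (forall n, Cmod (csum u n) <= B) -> Cmod l <= B.
Proof.
  intros H HB.
  exact (is_lim_seq_le _ (fun _ => B) (Cmod l) B HB (is_lim_seq_Cmod_csum u l H) (is_lim_seq_const B)).
Qed.

Lemma cseries_csum (u : nat -> nat -> C) (l : nat -> C) K :
  (forall k, cseries (fun n => u n k) (l k)) ->
  cseries (fun n => csum (u n) K) (csum l K).
Proof.
  intros H. unfold cseries.
  apply is_lim_seq_0_le with
    (v := fun N => sum_f_R0 (fun k => Cmod (csum (fun n => u n k) N - l k)%C) K).
  - intros N. split; [apply Cmod_ge_0|].
    rewrite csum_switch, <- csum_minus. apply Cmod_csum.
  - induction K; simpl.
    + apply H.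
    + replace 0 with (0 + 0) by ring. apply is_lim_seq_plus'; [exact IHK|apply H].
Qed.

Lemma sum_f_R0_incr (b : nat -> R) (N M : nat) :
  (forall n, 0 <= b n) -> (N <= M)%nat -> sum_f_R0 b N <= sum_f_R0 b M.
Proof.
  intros Hb H. induction H; [lra|]. simpl. specialize (Hb (S m)). lra.
Qed.

Lemma bounded_sum_tail (b : nat -> R) (B eps : R) :
  (forall n, 0 <= b n) -> (forall n, sum_f_R0 b n <= B) -> 0 < eps ->
  exists N, forall M, (N <= M)%nat -> sum_f_R0 b M - sum_f_R0 b N < eps.
Proof.
  intros Hb HB He.
  assert (G : Un_growing (sum_f_R0 b)).
  { intros n. apply sum_f_R0_incr; auto. }
  destruct (Un_cv_crit _ G) as [l Hl].
  { exists B. intros x [n ->]. apply HB. }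
  destruct (Hl eps He) as [N HN]. exists N. intros M HM.
  specialize (HN N (le_n N)). unfold Rdist in HN.
  pose proof (growing_ineq _ _ G Hl M). apply Rabs_def2 in HN. lra.
Qed.

Lemma csum_tail_le u (b : nat -> R) N M :
  (forall n, Cmod (u n) <= b n) -> (N <= M)%nat ->
  Cmod (csum u M - csum u N)%C <= sum_f_R0 b M - sum_f_R0 b N.
Proof.
  intros Hu H. induction H.
  - replace (csum u N - csum u N)%C with (RtoC 0) by ring. rewrite Cmod_0. lra.
  - simpl. replace (csum u m + u (S m) - csum u N)%C
      with ((csum u m - csum u N) + u (S m))%C by ring.
    eapply Rle_trans; [apply Cmod_triangle|]. specialize (Hu (S m)). lra.
Qed.

Lemma cseries_tail u l (b : nat -> R) N eps :
  cseries u l -> (forall n, Cmod (u n) <= b n) ->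
  (forall M, (N <= M)%nat -> sum_f_R0 b M - sum_f_R0 b N <= eps) ->
  Cmod (l - csum u N)%C <= eps.
Proof.
  intros H Hu Hb. apply Rnot_lt_le. intros Hlt.
  destruct (proj1 (cseries_eps u l) H (Cmod (l - csum u N)%C - eps)) as [N0 HN0]; [lra|].
  specialize (HN0 (max N0 N) (Nat.le_max_l _ _)).
  pose proof (csum_tail_le u b N (max N0 N) Hu (Nat.le_max_r _ _)).
  specialize (Hb (max N0 N) (Nat.le_max_r _ _)).
  pose proof (Cmod_sub_triangle l (csum u (max N0 N)) (csum u N)).
  rewrite (Cmod_sub_sym l (csum u (max N0 N))) in H1. lra.
Qed.

(** Completeness of the complex numbers: real and imaginary parts of the partial sums are
    Cauchy sequences, because the tails are dominated by those of a bounded sum. *)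
Lemma cseries_abs_ex u B :
  (forall n, sum_f_R0 (fun k => Cmod (u k)) n <= B) -> exists l, cseries u l.
Proof.
  intros HB.
  assert (Hre : forall g : C -> R,
    (forall x y, g (x + y)%C = g x + g y) -> (forall x, Rabs (g x) <= Cmod x) ->
    exists l, is_lim_seq (fun n => g (csum u n)) (Finite l)).
  { intros g Hg Hg'.
    assert (E : forall x y, g (x - y)%C = g x - g y).
    { intros x y. assert (g x = g (x - y)%C + g y) by (rewrite <- Hg; f_equal; ring). lra. }
    apply ex_lim_seq_cauchy_corr. intros [eps He].
    destruct (bounded_sum_tail (fun k => Cmod (u k)) B (eps / 2)) as [N HN]; auto.
    { intros; apply Cmod_ge_0. } { lra. }
    exists N. intros n m Hn Hm. simpl.
    replace (g (csum u n) - g (csum u m)) with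
      (g (csum u n - csum u N)%C - g (csum u m - csum u N)%C) by (rewrite !E; ring).
    pose proof (Hg' (csum u n - csum u N)%C). pose proof (Hg' (csum u m - csum u N)%C).
    pose proof (csum_tail_le u (fun k => Cmod (u k)) N n (fun k => Rle_refl _) Hn).
    pose proof (csum_tail_le u (fun k => Cmod (u k)) N m (fun k => Rle_refl _) Hm).
    pose proof (HN n Hn). pose proof (HN m Hm).
    eapply Rle_lt_trans; [apply Rabs_triang|]. rewrite Rabs_Ropp. lra. }
  destruct (Hre Re) as [x Hx]; [reflexivity|apply re_le_Cmod|].
  destruct (Hre Im) as [y Hy]; [reflexivity| |].
  { intros z. eapply Rle_trans; [|apply Rmax_Cmod]. apply Rmax_r. }
  exists (x, y). unfold cseries.
  apply is_lim_seq_0_le with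
    (v := fun n => Rabs (Re (csum u n) - x) + Rabs (Im (csum u n) - y)).
  - intros n. split; [apply Cmod_ge_0|].
    replace (csum u n - (x, y))%C with (Re (csum u n) - x, Im (csum u n) - y)
      by (destruct (csum u n); reflexivity).
    apply Cmod_pair_le.
  - assert (Z : forall v l, is_lim_seq v (Finite l) -> is_lim_seq (fun n => Rabs (v n - l)) 0).
    { intros v l Hv. rewrite <- Rabs_R0. apply (is_lim_seq_abs _ (Finite 0)).
      replace 0 with (l - l) by ring. apply is_lim_seq_minus'; [exact Hv|apply is_lim_seq_const]. }
    replace 0 with (0 + 0) by ring. apply is_lim_seq_plus'; apply Z; assumption.
Qed.

Lemma pow_n_C (z : C) n : @pow_n C_Ring z n = (z ^ n)%C.
Proof. induction n; [reflexivity|]. simpl. rewrite IHn. reflexivity. Qed.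

(** [is_pseries] over [C_AbsRing] unfolds to a convergence for the norm [Cmod], so that the
    elementary notion [cseries] carries the whole development. *)
Lemma cseries_pseries a (z l : C) :
  @is_pseries C_AbsRing (AbsRing_NormedModule C_AbsRing) a z l <->
  cseries (fun k => (a k * z ^ k)%C) l.
Proof.
  set (V := AbsRing_NormedModule C_AbsRing).
  set (s := fun k => @scal C_AbsRing V (@pow_n C_AbsRing z k) (a k)).
  assert (E : forall n, Cmod (csum (fun k => (a k * z ^ k)%C) n - l)%C =
     @norm C_AbsRing V (@minus V (@sum_n V s n) l)).
  { assert (E0 : forall k, (a k * z ^ k)%C = s k).
    { intros k. etransitivity; [apply Cmult_comm|]. rewrite <- (pow_n_C z k). reflexivity. }
    assert (E1 : forall n, csum (fun k => (a k * z ^ k)%C) n = @sum_n V s n).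
    { induction n.
      - symmetry. etransitivity; [apply sum_O|]. symmetry. apply E0.
      - symmetry. etransitivity; [apply sum_Sn|].
        change (@sum_n V s n + s (S n) = csum (fun k => (a k * z ^ k)%C) n + a (S n) * z ^ (S n))%C.
        rewrite IHn, E0. reflexivity. }
    intros n. rewrite E1. reflexivity. }
  rewrite cseries_eps. split.
  - intros H eps He.
    destruct (proj1 (filterlim_locally_ball_norm (U := V) (@sum_n V s) l) H (mkposreal _ He))
      as [N HN].
    exists N. intros n Hn. rewrite E. apply (HN n Hn).
  - intros H. apply (filterlim_locally_ball_norm (U := V) (@sum_n V s) l).
    intros [eps He]. destruct (H eps He) as [N HN].
    exists N. intros n Hn. specialize (HN n Hn). rewrite E in HN. exact HN.
Qed.

(** * The Wiener algebra of a disc *)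

(** The function is a power series on the closed disc of radius [r], with Wiener norm
    sum_k |a_k| r^k at most [B]. Only the values of [f] on that disc matter. *)
Definition wiener (r : R) (f : C -> C) (B : R) : Prop :=
  exists a : nat -> C,
    (forall N, sum_f_R0 (fun k => Cmod (a k) * r ^ k) N <= B) /\
    (forall w, Cmod w <= r -> cseries (fun k => (a k * w ^ k)%C) (f w)).

Lemma wiener_ext r f g B :
  (forall w, Cmod w <= r -> f w = g w) -> wiener r f B -> wiener r g B.
Proof.
  intros H (a & Ha & Hf). exists a. split; [exact Ha|].
  intros w Hw. rewrite <- H by exact Hw. auto.
Qed.

Lemma wiener_le r f B B' : B <= B' -> wiener r f B -> wiener r f B'.
Proof.
  intros H (a & Ha & Hf). exists a. split; [|exact Hf].
  intros N. eapply Rle_trans; [apply Ha|exact H].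
Qed.

Lemma Cmod_term_le a w k r : Cmod w <= r -> Cmod (a * w ^ k)%C <= Cmod a * r ^ k.
Proof.
  intros H. rewrite Cmod_mult, Cmod_pow. apply Rmult_le_compat_l; [apply Cmod_ge_0|].
  apply pow_incr. split; [apply Cmod_ge_0|exact H].
Qed.

Lemma wiener_Cmod_le r f B w : wiener r f B -> Cmod w <= r -> Cmod (f w) <= B.
Proof.
  intros (a & Ha & Hf) Hw. apply (cseries_Cmod_le _ _ _ (Hf w Hw)).
  intros n. eapply Rle_trans; [apply Cmod_csum|]. eapply Rle_trans; [|apply (Ha n)].
  apply sum_Rle. intros k _. apply Cmod_term_le, Hw.
Qed.

Lemma wiener_const r c : 0 <= r -> wiener r (fun _ => c) (Cmod c).
Proof.
  intros Hr. exists (fun k => match k with O => c | S _ => RtoC 0 end). split.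
  - intros N. apply Req_le. induction N; simpl; [ring|]. rewrite IHN, Cmod_0. ring.
  - intros w _. apply cseries_eps. intros eps He. exists O. intros n _.
    replace (csum _ n) with c.
    + replace (c - c)%C with (RtoC 0) by ring. rewrite Cmod_0. exact He.
    + induction n; simpl; [ring|]. rewrite <- IHn. ring.
Qed.

Lemma wiener_scal r c f B : wiener r f B -> wiener r (fun w => c * f w)%C (Cmod c * B).
Proof.
  intros (a & Ha & Hf). exists (fun k => c * a k)%C. split.
  - intros N. rewrite (sum_eq _ (fun k => Cmod (a k) * r ^ k * Cmod c)).
    + rewrite <- scal_sum. apply Rmult_le_compat_l; [apply Cmod_ge_0|apply Ha].
    + intros k _. rewrite Cmod_mult. ring.
  - intros w Hw. eapply cseries_ext; [|apply cseries_scal, (Hf w Hw)].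
    intros k. simpl. ring.
Qed.

Lemma wiener_minus r f g B B' :
  0 <= r -> wiener r f B -> wiener r g B' -> wiener r (fun w => f w - g w)%C (B + B').
Proof.
  intros Hr (a & Ha & Hf) (b & Hb & Hg). exists (fun k => a k - b k)%C. split.
  - intros N. eapply Rle_trans; [|apply Rplus_le_compat; [apply (Ha N)|apply (Hb N)]].
    rewrite <- plus_sum. apply sum_Rle. intros k _.
    rewrite <- Rmult_plus_distr_r. apply Rmult_le_compat_r; [apply pow_le, Hr|].
    unfold Cminus. rewrite <- (Cmod_opp (b k)). apply Cmod_triangle.
  - intros w Hw. eapply cseries_ext; [|apply (cseries_minus _ _ _ _ (Hf w Hw) (Hg w Hw))].
    intros k. simpl. ring.
Qed.

(** Multiplication by the variable shifts the coefficients. *)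
Lemma wiener_shift r f B :
  0 <= r -> wiener r f B -> wiener r (fun w => w * f w)%C (r * B).
Proof.
  intros Hr (a & Ha & Hf).
  exists (fun k => match k with O => RtoC 0 | S k => a k end). split.
  - intros [|N]; [simpl; rewrite Cmod_0, Rmult_0_l|].
    + specialize (Ha O). simpl in Ha. pose proof (Cmod_ge_0 (a O)). nra.
    + rewrite decomp_sum by lia. simpl pred. rewrite Cmod_0, Rmult_0_l, Rplus_0_l.
      rewrite (sum_eq _ (fun k => Cmod (a k) * r ^ k * r)).
      * rewrite <- scal_sum. apply Rmult_le_compat_l; [exact Hr|apply Ha].
      * intros k _. simpl. ring.
  - intros w Hw. apply cseries_incr. simpl.
    replace (w * f w - 0 * 1)%C with (w * f w)%C by ring.
    eapply cseries_ext; [|apply cseries_scal, (Hf w Hw)]. intros k. simpl. ring.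
Qed.

Lemma wiener_0_le r f B : wiener r f B -> 0 <= r -> 0 <= B.
Proof.
  intros H Hr. eapply Rle_trans; [apply Cmod_ge_0|].
  apply (wiener_Cmod_le r f B (RtoC 0) H). rewrite Cmod_0. exact Hr.
Qed.

(** Completeness of the Wiener algebra: a series of functions with summable norms can be
    summed coefficient by coefficient. This is the one place where a double series is
    rearranged; products, powers and exponentials are instances of it. *)
Lemma wiener_series r (f : nat -> C -> C) (b : nat -> R) F B :
  0 < r ->
  (forall n, wiener r (f n) (b n)) ->
  (forall N, sum_f_R0 b N <= B) ->
  (forall w, Cmod w <= r -> cseries (fun n => f n w) (F w)) ->
  wiener r F B.
Proof.
  intros Hr Hf HB HF.
  apply functional_choice in Hf. destruct Hf as [a Ha].
  assert (Hrk : forall k, 0 < r ^ k) by (intros; apply pow_lt, Hr).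
  assert (Hb : forall n, 0 <= b n).
  { intros n. destruct (Ha n) as [H _]. specialize (H O). simpl in H.
    pose proof (Cmod_ge_0 (a n O)). lra. }
  assert (Hswitch : forall K N,
    sum_f_R0 (fun k => sum_f_R0 (fun n => Cmod (a n k)) N * r ^ k) K <= sum_f_R0 b N).
  { intros K N. rewrite (sum_eq _ (fun k => sum_n (fun n => Cmod (a n k) * r ^ k) N)).
    - rewrite <- sum_n_Reals, <- sum_n_switch, sum_n_Reals.
      apply sum_Rle. intros n _. rewrite sum_n_Reals. apply (proj1 (Ha n)).
    - intros k _. rewrite sum_n_Reals, Rmult_comm, scal_sum. reflexivity. }
  assert (Hc : forall k, exists c, cseries (fun n => a n k) c).
  { intros k. apply cseries_abs_ex with (B / r ^ k). intros N.
    apply Rmult_le_reg_r with (r ^ k); [apply Hrk|].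
    replace (B / r ^ k * r ^ k) with B by (field; apply Rgt_not_eq, Hrk).
    eapply Rle_trans; [|apply (HB N)]. eapply Rle_trans; [|apply (Hswitch k N)].
    destruct k; simpl; [lra|].
    match goal with |- _ <= ?s + _ => assert (0 <= s) end; [|lra].
    apply cond_pos_sum. intros j. apply Rmult_le_pos; [|apply Rlt_le, Hrk].
    apply cond_pos_sum. intros; apply Cmod_ge_0. }
  apply functional_choice in Hc. destruct Hc as [c Hc].
  exists c. split.
  - intros K.
    assert (L : is_lim_seq
      (fun N => sum_f_R0 (fun k => Cmod (csum (fun n => a n k) N) * r ^ k) K)
      (sum_f_R0 (fun k => Cmod (c k) * r ^ k) K)).
    { assert (L0 : forall k, is_lim_seq (fun N => Cmod (csum (fun n => a n k) N) * r ^ k)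
          (Cmod (c k) * r ^ k)).
      { intros k. apply (is_lim_seq_scal_r _ (r ^ k) (Cmod (c k))).
        apply is_lim_seq_Cmod_csum, Hc. }
      induction K; simpl; [apply (L0 O)|].
      apply is_lim_seq_plus'; [exact IHK|apply (L0 (S K))]. }
    refine (is_lim_seq_le _ (fun _ => B) _ B _ L (is_lim_seq_const B)).
    intros N. eapply Rle_trans; [|apply (HB N)]. eapply Rle_trans; [|apply (Hswitch K N)].
    apply sum_Rle. intros k _. apply Rmult_le_compat_r; [apply Rlt_le, Hrk|apply Cmod_csum].
  - intros w Hw. apply cseries_eps. intros eps He.
    destruct (bounded_sum_tail b B (eps / 3) Hb HB) as [N HN]; [lra|].
    (* the first [N] functions converge; the others contribute little, uniformly in [K] *)
    assert (Hfin : is_lim_seq (fun K =>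
      Cmod (csum (fun n => csum (fun k => a n k * w ^ k)%C K - f n w)%C N)) 0).
    { apply is_lim_seq_0_le with
        (v := fun K => sum_f_R0 (fun n => Cmod (csum (fun k => a n k * w ^ k)%C K - f n w)%C) N).
      - intros K. split; [apply Cmod_ge_0|apply Cmod_csum].
      - clear HN. induction N; simpl; [apply (proj2 (Ha O) w Hw)|].
        replace 0 with (0 + 0) by ring.
        apply is_lim_seq_plus'; [exact IHN|apply (proj2 (Ha (S N)) w Hw)]. }
    destruct (proj1 (is_lim_seq_0_eps _ (fun K => Cmod_ge_0 _)) Hfin (eps / 3)) as [K0 HK0]; [lra|]. exists K0. intros K HK.
    specialize (HK0 K HK). rewrite csum_minus in HK0.
    assert (T1 : Cmod (F w - csum (fun n => f n w) N)%C <= eps / 3).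
    { apply (cseries_tail _ _ b N _ (HF w Hw)).
      - intros n. apply (wiener_Cmod_le r (f n) (b n) w); [|exact Hw]. exists (a n). apply Ha.
      - intros M HM. apply Rlt_le, HN, HM. }
    assert (T2 : Cmod (csum (fun k => c k * w ^ k)%C K -
        csum (fun n => csum (fun k => a n k * w ^ k)%C K) N)%C <= eps / 3).
    { apply (cseries_tail _ _ b N).
      - apply (cseries_csum (fun n k => a n k * w ^ k)%C). intros k.
        rewrite Cmult_comm. eapply cseries_ext; [|apply cseries_scal, Hc].
        intros n. simpl. ring.
      - intros n. eapply Rle_trans; [apply Cmod_csum|].
        eapply Rle_trans; [|apply (proj1 (Ha n) K)].
        apply sum_Rle. intros k _. apply Cmod_term_le, Hw.
      - intros M HM. apply Rlt_le, HN, HM. }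
    rewrite Cmod_sub_sym in T1.
    set (P := csum (fun n => csum (fun k => a n k * w ^ k)%C K) N) in *.
    set (Q := csum (fun n => f n w) N) in *.
    pose proof (Cmod_sub_triangle (csum (fun k => c k * w ^ k)%C K) P (F w)).
    pose proof (Cmod_sub_triangle P Q (F w)). lra.
Qed.

(** Expanding [f] only, the product is the series of the functions [a_n w^n g(w)], each of
    which is a shift of [g]. *)
Lemma wiener_mult r f g B B' :
  0 < r -> wiener r f B -> wiener r g B' -> wiener r (fun w => f w * g w)%C (B * B').
Proof.
  intros Hr (a & Ha & Hf) Hg.
  assert (Hn : forall n, wiener r (fun w => w ^ n * g w)%C (r ^ n * B')).
  { induction n; simpl.
    - rewrite Rmult_1_l. revert Hg. apply wiener_ext. intros; ring.
    - rewrite Rmult_assoc. apply wiener_shift in IHn; [|lra]. revert IHn.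
      apply wiener_ext. intros; ring. }
  apply (wiener_series r (fun n w => a n * (w ^ n * g w))%C
    (fun n => Cmod (a n) * (r ^ n * B'))); [exact Hr| | |].
  - intros n. apply wiener_scal, Hn.
  - intros N. rewrite (sum_eq _ (fun n => Cmod (a n) * r ^ n * B')) by (intros; ring).
    rewrite <- scal_sum, Rmult_comm. apply Rmult_le_compat_r; [|apply Ha].
    apply (wiener_0_le r g); [exact Hg|lra].
  - intros w Hw. rewrite Cmult_comm. eapply cseries_ext; [|apply cseries_scal, (Hf w Hw)].
    intros k. simpl. ring.
Qed.

Lemma wiener_pow r f B n :
  0 < r -> wiener r f B -> wiener r (fun w => f w ^ n)%C (B ^ n).
Proof.
  intros Hr Hf. induction n; simpl.
  - apply wiener_le with (Cmod 1); [rewrite Cmod_1; lra|]. apply wiener_const. lra.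
  - apply wiener_mult; assumption.
Qed.

Lemma wiener_translate r z0 : 0 < r -> wiener r (fun w => z0 + w)%C (Cmod z0 + r).
Proof.
  intros Hr.
  pose proof (wiener_minus r _ _ _ _ (Rlt_le _ _ Hr) (wiener_const r z0 (Rlt_le _ _ Hr))
    (wiener_shift r _ _ (Rlt_le _ _ Hr) (wiener_const r (-(1))%C (Rlt_le _ _ Hr)))) as H.
  rewrite Cmod_m1, Rmult_1_r in H. revert H. apply wiener_ext. intros; ring.
Qed.

(** The quotient [(f w - f 0) / w] is the shifted power series. Iterating this gives Taylor
    expansions with a bounded remainder. *)
Lemma wiener_decomp r f B :
  0 < r -> wiener r f B ->
  exists f1 B1, wiener r f1 B1 /\ forall w, Cmod w <= r -> f w = (f 0 + w * f1 w)%C.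
Proof.
  intros Hr (a & Ha & Hf).
  assert (Hb : forall N, sum_f_R0 (fun k => Cmod (a (S k)) * r ^ k) N <= B / r).
  { intros N. apply Rmult_le_reg_r with r; [exact Hr|].
    replace (B / r * r) with B by (field; lra).
    eapply Rle_trans; [|apply (Ha (S N))]. rewrite (decomp_sum _ (S N)) by lia. simpl pred.
    rewrite Rmult_comm, scal_sum.
    rewrite (sum_eq _ (fun k => Cmod (a (S k)) * r ^ S k)) by (intros; simpl; ring).
    pose proof (Cmod_ge_0 (a O)). rewrite pow_O. lra. }
  assert (H0 : f 0 = a O).
  { apply (cseries_unique (fun k => a k * 0 ^ k)%C).
    - apply Hf. rewrite Cmod_0. lra.
    - apply cseries_incr. simpl. apply cseries_eps. intros eps He. exists O. intros n _.
      replace (csum _ n) with (RtoC 0).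
      + replace (0 - (a O - a O * 1))%C with (RtoC 0) by ring. rewrite Cmod_0. exact He.
      + induction n; simpl; [ring|]. rewrite <- IHn. ring. }
  assert (Hs : forall w, exists l, Cmod w <= r -> cseries (fun k => a (S k) * w ^ k)%C l).
  { intros w. destruct (Rle_dec (Cmod w) r) as [Hw|Hw].
    - destruct (cseries_abs_ex (fun k => a (S k) * w ^ k)%C (B / r)) as [l Hl].
      + intros N. eapply Rle_trans; [|apply (Hb N)]. apply sum_Rle. intros k _.
        apply Cmod_term_le, Hw.
      + exists l. auto.
    - exists (RtoC 0). intros; contradiction. }
  apply functional_choice in Hs. destruct Hs as [f1 Hf1].
  exists f1, (B / r). split.
  - exists (fun k => a (S k)). split; assumption.
  - intros w Hw. apply (cseries_unique _ _ _ (Hf w Hw)).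
    apply cseries_incr. simpl. rewrite H0.
    replace (a O + w * f1 w - a O * 1)%C with (w * f1 w)%C by ring.
    eapply cseries_ext; [|apply cseries_scal, (Hf1 w Hw)]. intros k. simpl. ring.
Qed.

(** * The complex exponential *)

Definition cexp (z : C) : C := (exp (Re z) * cos (Im z), exp (Re z) * sin (Im z)).

Lemma Cmod_cexp z : Cmod (cexp z) = exp (Re z).
Proof.
  unfold Cmod, cexp; simpl.
  replace (_ + _) with (exp (Re z) ^ 2).
  - apply sqrt_pow2. apply Rlt_le, exp_pos.
  - pose proof (sin2_cos2 (Im z)) as H. unfold Rsqr in H.
    transitivity (exp (Re z) ^ 2 * (sin (Im z) * sin (Im z) + cos (Im z) * cos (Im z))); [|ring].
    rewrite H. ring.
Qed.

Lemma cexp_neq_0 z : cexp z <> 0.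
Proof. apply Cmod_gt_0. rewrite Cmod_cexp. apply exp_pos. Qed.

Lemma cexp_0 : cexp 0 = 1.
Proof. unfold cexp; simpl. rewrite exp_0, cos_0, sin_0. unfold RtoC. f_equal; ring. Qed.

Lemma is_derive_cexp_ray (c z : C) (t : R) :
  is_derive (fun t : R => Re (c * cexp (t * z))%C) t (Re (c * z * cexp (t * z))%C).
Proof.
  destruct c as [c1 c2], z as [x y]. unfold cexp, Cmult, Re, Im, RtoC. simpl.
  auto_derive; [exact I|]. unfold Rminus. ring.
Qed.

Lemma is_derive_n_cexp_ray (c z : C) n (t : R) :
  is_derive_n (fun t : R => Re (c * cexp (t * z))%C) n t (Re (c * z ^ n * cexp (t * z))%C).
Proof.
  revert t. induction n; intros t.
  - cbn [is_derive_n Cpow]. rewrite Cmult_1_r. reflexivity.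
  - cbn [is_derive_n Cpow]. apply (is_derive_ext (fun t : R => Re (c * z ^ n * cexp (t * z))%C)).
    + intros s. symmetry. apply is_derive_n_unique, IHn.
    + replace (c * (z * z ^ n))%C with (c * z ^ n * z)%C by ring.
      apply is_derive_cexp_ray.
Qed.

Lemma Re_csum u n : Re (csum u n) = sum_f_R0 (fun k => Re (u k)) n.
Proof. induction n; simpl; [|rewrite <- IHn]; reflexivity. Qed.

(** Lagrange's form of the remainder holds for real functions only; along the ray from 0 to
    [z] the constant [c] selects the real part ([c = 1]) or the imaginary part ([c = - Ci]). *)
Lemma cexp_taylor (c z : C) n :
  Rabs (Re (c * (csum (fun k => / INR (fact k) * z ^ k) n - cexp z))%C)
  <= Cmod c * exp (Cmod z) * (Cmod z ^ S n / INR (fact (S n))).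
Proof.
  destruct (Taylor_Lagrange (fun t : R => Re (c * cexp (t * z))%C) n 0 1) as (s & Hs & E); [lra| |].
  { intros t _ k _. destruct k; [exact I|].
    exists (Re (c * z ^ S k * cexp (t * z))%C). apply (is_derive_n_cexp_ray c z (S k) t). }
  rewrite (is_derive_n_unique _ _ _ _ (is_derive_n_cexp_ray c z (S n) s)) in E.
  replace (Re (c * (csum (fun k => / INR (fact k) * z ^ k) n - cexp z))%C) with
    (- ((1 - 0) ^ S n / INR (fact (S n)) * Re (c * z ^ S n * cexp (s * z))%C)).
  - rewrite Rabs_Ropp, Rabs_mult, Rminus_0_r, pow1.
    assert (Hf : 0 < / INR (fact (S n))) by (apply Rinv_0_lt_compat, INR_fact_lt_0).
    unfold Rdiv. rewrite Rmult_1_l, (Rabs_pos_eq (/ _)) by lra.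
    pose proof (re_le_Cmod (c * z ^ S n * cexp (s * z))%C) as H.
    rewrite !Cmod_mult, Cmod_pow, Cmod_cexp in H.
    assert (exp (Re (s * z)%C) <= exp (Cmod z)).
    { destruct (Req_dec (Re (s * z)%C) (Cmod z)) as [->|Hne]; [lra|].
      apply Rlt_le, exp_increasing. apply Rnot_le_lt. intros Hle. apply Hne.
      apply Rle_antisym; [|exact Hle].
      eapply Rle_trans; [apply Rle_abs|]. eapply Rle_trans; [apply re_le_Cmod|].
      rewrite Cmod_mult, Cmod_R, Rabs_pos_eq by lra. pose proof (Cmod_ge_0 z). nra. }
    assert (0 <= Cmod c * Cmod z ^ S n).
    { apply Rmult_le_pos; [apply Cmod_ge_0|apply pow_le, Cmod_ge_0]. }
    replace (Cmod c * exp (Cmod z) * (Cmod z ^ S n * / INR (fact (S n)))) with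
      (/ INR (fact (S n)) * (Cmod c * Cmod z ^ S n * exp (Cmod z))) by ring.
    apply Rmult_le_compat_l; [lra|]. eapply Rle_trans; [exact H|].
    apply Rmult_le_compat_l; assumption.
  - match type of E with ?a = ?b + ?d => assert (E' : - d = b - a) by lra end.
    rewrite E'. clear E E'.
    replace (c * (csum (fun k => / INR (fact k) * z ^ k) n - cexp z))%C with
      (csum (fun k => c * (/ INR (fact k) * z ^ k)) n - c * cexp z)%C
      by (rewrite csum_scal; ring).
    unfold Cminus.
    replace (Re (csum (fun k => (c * (/ INR (fact k) * z ^ k))%C) n + - (c * cexp z))%C)
     with (Re (csum (fun k => (c * (/ INR (fact k) * z ^ k))%C) n) - Re (c * cexp z)%C)
     by (unfold Re, Cplus, Copp; simpl; ring).
    rewrite Re_csum. f_equal; [|f_equal; f_equal; f_equal; ring].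
    apply sum_eq. intros k _.
    rewrite (is_derive_n_unique _ _ _ _ (is_derive_n_cexp_ray c z k 0)).
    rewrite Rminus_0_r, pow1. unfold Rdiv. rewrite Rmult_1_l.
    replace (0 * z)%C with (RtoC 0) by ring. rewrite cexp_0, Cmult_1_r.
    replace (c * (/ INR (fact k) * z ^ k))%C with (/ INR (fact k) * (c * z ^ k))%C by ring.
    rewrite <- RtoC_inv by apply INR_fact_neq_0.
    unfold Re, Cmult, RtoC. simpl. ring.
Qed.

Lemma cexp_series z : cseries (fun k => / INR (fact k) * z ^ k)%C (cexp z).
Proof.
  assert (Z : forall c, is_lim_seq (fun n =>
     Rabs (Re (c * (csum (fun k => / INR (fact k) * z ^ k) n - cexp z))%C)) 0).
  { intros c. eapply is_lim_seq_0_le.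
    { intros n. split; [apply Rabs_pos|apply cexp_taylor]. }
    replace (Finite 0) with (Rbar_mult (Cmod c * exp (Cmod z)) 0) by (simpl; f_equal; ring).
    apply is_lim_seq_scal_l.
    apply (is_lim_seq_incr_1 (fun n => Cmod z ^ n / INR (fact n))).
    apply is_lim_seq_Reals, cv_speed_pow_fact. }
  apply is_lim_seq_0_le with (v := fun n =>
     Rabs (Re (1 * (csum (fun k => / INR (fact k) * z ^ k) n - cexp z))%C) +
     Rabs (Re (- Ci * (csum (fun k => / INR (fact k) * z ^ k) n - cexp z))%C)).
  - intros n. split; [apply Cmod_ge_0|].
    generalize (csum (fun k : nat => (/ INR (fact k) * z ^ k)%C) n - cexp z)%C. intros [p q].
    replace (Re (1 * (p, q))%C) with p by (simpl; ring).
    replace (Re (- Ci * (p, q))%C) with q by (simpl; ring).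
    apply Cmod_pair_le.
  - replace 0 with (0 + 0) by ring. apply is_lim_seq_plus'; apply Z.
Qed.

(** The exponential series of [f] converges in the Wiener algebra. *)
Lemma wiener_cexp r f B :
  0 < r -> wiener r f B -> wiener r (fun w => cexp (f w)) (exp B).
Proof.
  intros Hr Hf. pose proof (wiener_0_le r f B Hf (Rlt_le _ _ Hr)) as HB.
  apply (wiener_series r (fun n w => / INR (fact n) * f w ^ n)%C
    (fun n => / INR (fact n) * B ^ n)); [exact Hr| | |].
  - intros n.
    apply wiener_le with (Cmod (/ INR (fact n))%C * B ^ n); [|apply wiener_scal, wiener_pow; assumption].
    rewrite <- RtoC_inv by apply INR_fact_neq_0.
    rewrite Cmod_R, Rabs_pos_eq; [lra|]. apply Rlt_le, Rinv_0_lt_compat, INR_fact_lt_0.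
  - intros N. pose proof (is_exp_Reals B) as He. apply is_pseries_R, is_series_Reals in He.
    apply (sum_incr _ N _ He). intros n. apply Rmult_le_pos; [|apply pow_le, HB].
    apply Rlt_le, Rinv_0_lt_compat, INR_fact_lt_0.
  - intros w _. apply cexp_series.
Qed.

(** * Functions analytic at a point *)

Definition wiener_at (f : C -> C) (z0 : C) : Prop :=
  exists r B : R, 0 < r /\ wiener r (fun w => f (z0 + w)%C) B.

Lemma cseries_terms_bounded u l :
  cseries u l -> exists K, forall n, Cmod (u n) <= K.
Proof.
  intros H. destruct (maj_by_pos (fun n => Cmod (csum u n))) as (K & HK & Hb).
  { exists (Cmod l). apply is_lim_seq_Reals, is_lim_seq_Cmod_csum, H. }
  assert (Hb' : forall n, Cmod (csum u n) <= K).
  { intros n. specialize (Hb n). rewrite Rabs_pos_eq in Hb; [exact Hb|apply Cmod_ge_0]. }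
  exists (K + K). intros [|n].
  - specialize (Hb' O). simpl in Hb'. lra.
  - pose proof (Hb' n). pose proof (Hb' (S n)). simpl in H1.
    replace (u (S n)) with ((csum u n + u (S n)) - csum u n)%C by ring.
    unfold Cminus. eapply Rle_trans; [apply Cmod_triangle|]. rewrite Cmod_opp. lra.
Qed.

Lemma sum_geom_half_le n : sum_f_R0 (fun k => (1 / 2) ^ k) n <= 2.
Proof.
  rewrite tech3 by lra. assert (0 < (1 / 2) ^ S n) by (apply pow_lt; lra). lra.
Qed.

(** On half the radius the terms of the power series are bounded; on a quarter of it they
    are dominated by a geometric series. *)
Lemma analytic_on_wiener_at U f z0 : analytic_on U f -> U z0 -> wiener_at f z0.
Proof.
  intros Hf Hz. destruct (Hf z0 Hz) as (a & r & Hr & Ha).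
  assert (Ha' : forall w, Cmod w < r -> cseries (fun k => a k * w ^ k)%C (f (z0 + w)%C)).
  { intros w Hw. apply cseries_pseries.
    replace w with (z0 + w - z0)%C at 1 by ring. apply Ha.
    replace (z0 + w - z0)%C with w by ring. exact Hw. }
  assert (Hr2 : Cmod (RtoC (r / 2)) < r) by (rewrite Cmod_R, Rabs_pos_eq; lra).
  destruct (cseries_terms_bounded _ _ (Ha' _ Hr2)) as [K HK].
  exists (r / 4), (2 * K). split; [lra|]. exists a. split.
  - intros N. apply Rle_trans with (sum_f_R0 (fun k => (1 / 2) ^ k * K) N).
    + apply sum_Rle. intros k _. specialize (HK k).
      rewrite Cmod_mult, Cmod_pow, Cmod_R, Rabs_pos_eq in HK by lra.
      replace (r / 4) with (1 / 2 * (r / 2)) by field. rewrite Rpow_mult_distr.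
      assert (0 < (1 / 2) ^ k) by (apply pow_lt; lra). nra.
    + rewrite <- scal_sum, Rmult_comm. apply Rmult_le_compat_r; [|apply sum_geom_half_le].
      eapply Rle_trans; [apply Cmod_ge_0|apply (HK O)].
  - intros w Hw. apply Ha'. lra.
Qed.

Lemma wiener_at_analytic_on (U : C -> Prop) f :
  (forall z, U z -> wiener_at f z) -> analytic_on U f.
Proof.
  intros H z0 Hz. destruct (H z0 Hz) as (r & B & Hr & a & _ & Ha).
  exists a, r. split; [exact Hr|]. intros z Hw. apply cseries_pseries.
  replace (f z) with (f (z0 + (z - z0))%C) by (f_equal; ring). apply Ha. lra.
Qed.

Lemma wiener_restrict r r' f B : 0 <= r' <= r -> wiener r f B -> wiener r' f B.
Proof.
  intros Hr (a & Ha & Hf). exists a. split.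
  - intros N. eapply Rle_trans; [|apply (Ha N)]. apply sum_Rle. intros k _.
    apply Rmult_le_compat_l; [apply Cmod_ge_0|]. apply pow_incr. lra.
  - intros w Hw. apply Hf. lra.
Qed.

Lemma wiener_at_mult f g z0 :
  wiener_at f z0 -> wiener_at g z0 -> wiener_at (fun z => f z * g z)%C z0.
Proof.
  intros (r & B & Hr & Hf) (r' & B' & Hr' & Hg).
  assert (0 < Rmin r r') by (apply Rmin_glb_lt; assumption).
  pose proof (Rmin_l r r'). pose proof (Rmin_r r r').
  exists (Rmin r r'), (B * B'). split; [assumption|].
  apply wiener_mult; [assumption| |].
  - apply wiener_restrict with r; [lra|exact Hf].
  - apply wiener_restrict with r'; [lra|exact Hg].
Qed.

Lemma wiener_at_minus f g z0 :
  wiener_at f z0 -> wiener_at g z0 -> wiener_at (fun z => f z - g z)%C z0.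
Proof.
  intros (r & B & Hr & Hf) (r' & B' & Hr' & Hg).
  assert (0 < Rmin r r') by (apply Rmin_glb_lt; assumption).
  pose proof (Rmin_l r r'). pose proof (Rmin_r r r').
  exists (Rmin r r'), (B + B'). split; [assumption|].
  apply wiener_minus; [lra| |].
  - apply wiener_restrict with r; [lra|exact Hf].
  - apply wiener_restrict with r'; [lra|exact Hg].
Qed.

Lemma wiener_at_opp f z0 : wiener_at f z0 -> wiener_at (fun z => - f z)%C z0.
Proof.
  intros (r & B & Hr & Hf). exists r, (Cmod (- (1)) * B)%R. split; [exact Hr|].
  eapply wiener_ext; [|apply wiener_scal, Hf]. intros w _. simpl. ring.
Qed.

Lemma wiener_at_cexp f z0 : wiener_at f z0 -> wiener_at (fun z => cexp (f z)) z0.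
Proof.
  intros (r & B & Hr & Hf). exists r, (exp B). split; [exact Hr|].
  apply (wiener_cexp r (fun w => f (z0 + w)%C)); assumption.
Qed.

Lemma wiener_at_const c z0 : wiener_at (fun _ => c) z0.
Proof. exists 1, (Cmod c). split; [lra|]. apply wiener_const. lra. Qed.

Lemma wiener_at_id z0 : wiener_at (fun z => z) z0.
Proof. exists 1, (Cmod z0 + 1). split; [lra|]. apply wiener_translate. lra. Qed.

Lemma wiener_at_lipschitz g z0 :
  wiener_at g z0 -> exists r L, 0 < r /\ 0 <= L /\
    forall w, Cmod w <= r -> Cmod (g (z0 + w)%C) <= Cmod (g z0) + L * Cmod w.
Proof.
  intros (r & B & Hr & H). destruct (wiener_decomp r _ B Hr H) as (f1 & B1 & H1 & E).
  exists r, B1. split; [exact Hr|]. split; [apply (wiener_0_le r f1); [exact H1|lra]|].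
  intros w Hw. rewrite (E w Hw). replace (z0 + 0)%C with z0 by ring.
  eapply Rle_trans; [apply Cmod_triangle|]. rewrite Cmod_mult.
  pose proof (wiener_Cmod_le r f1 B1 w H1 Hw). pose proof (Cmod_ge_0 w). nra.
Qed.

(** Adding [d |z|^2] makes [|g|] strictly subharmonic. In the sum of [g] over the four
    points [z0 + s], [z0 - s], [z0 + i s], [z0 - i s] the Taylor terms of degrees 1 and 2
    cancel, so [|g z0|] exceeds the mean of [|g|] by at most a multiple of [s^3], whereas
    the mean of [d |z|^2] exceeds its value at [z0] by [d s^2]. *)
Lemma wiener_at_no_local_max g z0 d rho :
  wiener_at g z0 -> 0 < d -> 0 < rho ->
  exists w, Cmod w <= rho /\
    Cmod (g z0) + d * Cmod z0 ^ 2 < Cmod (g (z0 + w)%C) + d * Cmod (z0 + w)%C ^ 2.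
Proof.
  intros (r & B & Hr & H0) Hd Hrho.
  destruct (wiener_decomp r _ B Hr H0) as (f1 & B1 & H1 & E1).
  destruct (wiener_decomp r _ B1 Hr H1) as (f2 & B2 & H2 & E2).
  destruct (wiener_decomp r _ B2 Hr H2) as (f3 & B3 & H3 & E3).
  pose proof (wiener_0_le r f3 B3 H3 (Rlt_le _ _ Hr)) as HB3.
  (* The step [s] is so small that [s B3 < d], where [B3] bounds the cubic remainder. *)
  set (s := Rmin (Rmin r rho) (d / (B3 + 1))).
  assert (Hs : 0 < s).
  { apply Rmin_glb_lt; [apply Rmin_glb_lt; assumption|].
    apply Rdiv_lt_0_compat; lra. }
  assert (Hsr : s <= r) by (eapply Rle_trans; [apply Rmin_l|apply Rmin_l]).
  assert (Hsrho : s <= rho) by (eapply Rle_trans; [apply Rmin_l|apply Rmin_r]).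
  assert (HsB : s * B3 < d).
  { assert (s <= d / (B3 + 1)) by apply Rmin_r.
    apply Rlt_le_trans with (s * (B3 + 1)); [nra|].
    apply Rle_trans with (d / (B3 + 1) * (B3 + 1)); [nra|]. apply Req_le. field. lra. }
  assert (E : forall w, Cmod w = s -> g (z0 + w)%C =
    (g z0 + w * f1 0 + w * w * f2 0 + w * w * w * f3 w)%C).
  { intros w Hw. rewrite (E1 w), (E2 w), (E3 w) by lra.
    replace (z0 + 0)%C with z0 by ring. ring. }
  set (w1 := RtoC s). set (w2 := (Ci * s)%C).
  assert (Hw1 : Cmod w1 = s) by (unfold w1; rewrite Cmod_R, Rabs_pos_eq; lra).
  assert (Hw2 : Cmod w2 = s) by (unfold w2; rewrite Cmod_mult, Cmod_Ci, Cmod_R, Rabs_pos_eq; lra).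
  assert (Hn : forall w, Cmod w = s -> Cmod (- w)%C = s) by (intros; rewrite Cmod_opp; assumption).
  apply NNPP. intros Hno.
  assert (Hle : forall w, Cmod w = s ->
     Cmod (g (z0 + w)%C) + d * Cmod (z0 + w)%C ^ 2 <= Cmod (g z0) + d * Cmod z0 ^ 2).
  { intros w Hw. apply Rnot_lt_le. intros Hlt. apply Hno. exists w. split; [lra|exact Hlt]. }
  pose proof (Hle w1 Hw1) as L1. pose proof (Hle (- w1)%C (Hn _ Hw1)) as L2.
  pose proof (Hle w2 Hw2) as L3. pose proof (Hle (- w2)%C (Hn _ Hw2)) as L4.
  assert (HQ : Cmod (z0 + w1)%C ^ 2 + Cmod (z0 + - w1)%C ^ 2 +
    (Cmod (z0 + w2)%C ^ 2 + Cmod (z0 + - w2)%C ^ 2) = 4 * Cmod z0 ^ 2 + 4 * s ^ 2).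
  { rewrite !Cmod2_alt. unfold w1, w2. destruct z0 as [x y]. simpl. ring. }
  (* the linear and quadratic terms cancel in the sum over the four points *)
  assert (Hsum : (4 * g z0 = (g (z0 + w1) + g (z0 + - w1) + (g (z0 + w2) + g (z0 + - w2)))
    - (w1 * w1 * w1 * f3 w1 - w1 * w1 * w1 * f3 (- w1)
       + (w2 * w2 * w2 * f3 w2 - w2 * w2 * w2 * f3 (- w2))))%C).
  { rewrite (E w1), (E (- w1)%C), (E w2), (E (- w2)%C) by auto.
    replace (w2 * w2)%C with (- (w1 * w1))%C.
    - replace (- w2 * - w2)%C with (w2 * w2)%C by ring.
      replace (w2 * w2)%C with (- (w1 * w1))%C; [ring|].
      unfold w2, w1. unfold Ci, Cmult, Copp, RtoC. simpl. f_equal; ring.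
    - unfold w2, w1. unfold Ci, Cmult, Copp, RtoC. simpl. f_equal; ring. }
  assert (C3 : forall w w', Cmod w = s -> Cmod w' = s ->
    Cmod (w * w * w * f3 w')%C <= s * s * s * B3).
  { intros w w' Hw Hw'. rewrite !Cmod_mult, Hw.
    pose proof (wiener_Cmod_le r f3 B3 w' H3). assert (0 < s * s * s) by (apply Rmult_lt_0_compat; nra).
    apply Rmult_le_compat_l; [lra|]. apply H. lra. }
  pose proof (C3 w1 w1 Hw1 Hw1). pose proof (C3 w1 (- w1)%C Hw1 (Hn _ Hw1)).
  pose proof (C3 w2 w2 Hw2 Hw2). pose proof (C3 w2 (- w2)%C Hw2 (Hn _ Hw2)).
  assert (T : 4 * Cmod (g z0) <= Cmod (g (z0 + w1)%C) + Cmod (g (z0 + - w1)%C) +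
     (Cmod (g (z0 + w2)%C) + Cmod (g (z0 + - w2)%C)) + 4 * (s * s * s * B3)).
  { replace (4 * Cmod (g z0)) with (Cmod (4 * g z0)%C).
    - rewrite Hsum.
      assert (T : forall a b, Cmod (a + b)%C <= Cmod a + Cmod b) by apply Cmod_triangle.
      assert (T' : forall a b, Cmod (a - b)%C <= Cmod a + Cmod b).
      { intros a b. rewrite <- (Cmod_opp b). apply T. }
      eapply Rle_trans; [apply T'|].
      pose proof (T (g (z0 + w1)%C + g (z0 + - w1)%C)%C (g (z0 + w2) + g (z0 + - w2))%C).
      pose proof (T (g (z0 + w1)%C) (g (z0 + - w1)%C)).
      pose proof (T (g (z0 + w2)%C) (g (z0 + - w2)%C)).
      pose proof (T (w1 * w1 * w1 * f3 w1 - (w1 * w1 * w1 * f3 (- w1)))%C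
         (w2 * w2 * w2 * f3 w2 - (w2 * w2 * w2 * f3 (- w2)))%C).
      pose proof (T' (w1 * w1 * w1 * f3 w1)%C (w1 * w1 * w1 * f3 (- w1))%C).
      pose proof (T' (w2 * w2 * w2 * f3 w2)%C (w2 * w2 * w2 * f3 (- w2))%C).
      lra.
    - rewrite Cmod_mult, Cmod_R, Rabs_pos_eq; lra. }
  assert (d * s ^ 2 <= s * s * s * B3) by nra.
  assert (0 < s * s * (d - s * B3)) by (apply Rmult_lt_0_compat; nra).
  lra.
Qed.

(** * The maximum modulus principle on a rectangle *)

(** A local property that gets weaker as [d] decreases holds with a common [d] on the
    compact rectangle. *)
Lemma rect_uniform (a b a' b' : R) (P : R -> R -> R -> Prop) :
  (forall e d x y, 0 < e <= d -> P d x y -> P e x y) ->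
  (forall u v, a <= u <= b -> a' <= v <= b' -> exists d, 0 < d /\
     forall x y, Rabs (x - u) < d -> Rabs (y - v) < d -> P d x y) ->
  exists d, 0 < d /\ forall x y, a <= x <= b -> a' <= y <= b' -> P d x y.
Proof.
  intros Hmono Hloc.
  assert (H : forall p : R * R, exists d : posreal, a <= fst p <= b -> a' <= snd p <= b' ->
    forall x y, Rabs (x - fst p) < d -> Rabs (y - snd p) < d -> P d x y).
  { intros [u v]. simpl. destruct (classic (a <= u <= b /\ a' <= v <= b')) as [[Hu Hv]|Hn].
    - destruct (Hloc u v Hu Hv) as (d & Hd & H). exists (mkposreal d Hd). intros _ _. exact H.
    - exists (mkposreal 1 Rlt_0_1). intros Hu Hv. exfalso. apply Hn. split; assumption. }
  apply functional_choice in H. destruct H as [delta Hdelta].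
  destruct (compactness_value_2d a b a' b' (fun u v => delta (u, v))) as [d Hd].
  exists d. split; [apply cond_pos|]. intros x y Hx Hy.
  apply NNPP. intros Hn. apply (Hd x y Hx Hy). intros (u & v & Hu & Hv & Hxu & Hyv & Hle).
  apply Hn. apply Hmono with (delta (u, v)); [split; [apply cond_pos|exact Hle]|].
  apply (Hdelta (u, v)); assumption.
Qed.

(** [rect_uniform] is applied twice: first to bound [v],
    then, if the supremum [s] is not attained, to keep [v] below [s - d]. *)
Lemma rect_max (a b a' b' : R) (v : R -> R -> R) :
  a <= b -> a' <= b' ->
  (forall x y, a <= x <= b -> a' <= y <= b' -> forall e, 0 < e ->
     exists d, 0 < d /\
     forall x' y', Rabs (x' - x) < d -> Rabs (y' - y) < d -> v x' y' < v x y + e) ->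
  exists x y, a <= x <= b /\ a' <= y <= b' /\
    forall x' y', a <= x' <= b -> a' <= y' <= b' -> v x' y' <= v x y.
Proof.
  intros Hab Hab' Husc.
  destruct (rect_uniform a b a' b' (fun d x y => v x y <= / d)) as (d & Hd & Hbd).
  { intros e d x y He H. eapply Rle_trans; [exact H|]. apply Rinv_le_contravar; lra. }
  { intros x y Hx Hy. destruct (Husc x y Hx Hy 1 Rlt_0_1) as (d & Hd & H).
    pose proof (Rabs_pos (v x y)). pose proof (Rle_abs (v x y)).
    assert (Hi : 0 < / (Rabs (v x y) + 1)) by (apply Rinv_0_lt_compat; lra).
    exists (Rmin d (/ (Rabs (v x y) + 1))). split; [apply Rmin_glb_lt; assumption|].
    intros x' y' Hx' Hy'. apply Rle_trans with (Rabs (v x y) + 1).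
    - pose proof (Rmin_l d (/ (Rabs (v x y) + 1))). specialize (H x' y'). lra.
    - rewrite <- (Rinv_inv (Rabs (v x y) + 1)) at 1. apply Rinv_le_contravar.
      + apply Rmin_glb_lt; assumption.
      + apply Rmin_r. }
  destruct (completeness (fun t => exists x y, a <= x <= b /\ a' <= y <= b' /\ t = v x y))
    as [s [Hub Hlub]].
  { exists (/ d). intros t (x & y & Hx & Hy & ->). apply Hbd; assumption. }
  { exists (v a a'), a, a'. lra. }
  apply NNPP. intros Hn.
  assert (Hlt : forall x y, a <= x <= b -> a' <= y <= b' -> v x y < s).
  { intros x y Hx Hy. apply Rnot_le_lt. intros Hle. apply Hn. exists x, y.
    split; [exact Hx|]. split; [exact Hy|]. intros x' y' Hx' Hy'.
    apply Rle_trans with s; [|exact Hle]. apply Hub. exists x', y'. auto. }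
  destruct (rect_uniform a b a' b' (fun d x y => v x y <= s - d)) as (e & He & Hbe).
  { intros e d' x y He H. lra. }
  { intros x y Hx Hy. specialize (Hlt x y Hx Hy).
    destruct (Husc x y Hx Hy ((s - v x y) / 2)) as (d' & Hd' & H); [lra|].
    exists (Rmin d' ((s - v x y) / 2)). split; [apply Rmin_glb_lt; lra|].
    intros x' y' Hx' Hy'. pose proof (Rmin_l d' ((s - v x y) / 2)).
    pose proof (Rmin_r d' ((s - v x y) / 2)). specialize (H x' y'). lra. }
  assert (s <= s - e); [|lra].
  apply Hlub. intros t (x & y & Hx & Hy & ->). apply Hbe; assumption.
Qed.

(** If [|g z|] exceeded [B], then for small [d] the maximum of [|g| + d |z|^2] over the
    rectangle would exceed all boundary values and be attained inside, against
    [wiener_at_no_local_max]. *)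
Lemma max_modulus_rect (g : C -> C) (a b h B : R) :
  a <= b -> 0 <= h ->
  (forall z, a <= Re z <= b -> - h <= Im z <= h -> wiener_at g z) ->
  (forall z, a <= Re z <= b -> - h <= Im z <= h ->
     Re z = a \/ Re z = b \/ Im z = - h \/ Im z = h -> Cmod (g z) <= B) ->
  forall z, a <= Re z <= b -> - h <= Im z <= h -> Cmod (g z) <= B.
Proof.
  intros Hab Hh Hg HB z Hx Hy. apply Rnot_lt_le. intros Hlt.
  set (Qm := a ^ 2 + b ^ 2 + h ^ 2).
  assert (HQ : 0 <= Qm) by (unfold Qm; nra).
  set (d := (Cmod (g z) - B) / (Qm + 1)).
  assert (Hd : 0 < d) by (apply Rdiv_lt_0_compat; lra).
  assert (HdQ : d * Qm < Cmod (g z) - B).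
  { replace (Cmod (g z) - B) with (d * (Qm + 1)) by (unfold d; field; lra). nra. }
  set (v := fun x y => Cmod (g (x, y)) + d * Cmod (x, y) ^ 2).
  assert (Hrect : forall z', a <= Re z' <= b -> - h <= Im z' <= h -> Cmod z' ^ 2 <= Qm).
  { intros z' H1 H2. rewrite Cmod2_alt. unfold Qm.
    assert (Re z' ^ 2 <= a ^ 2 + b ^ 2).
    { pose proof (pow2_ge_0 a). pose proof (pow2_ge_0 b).
      destruct (Rle_dec 0 (Re z')).
      - assert (Re z' ^ 2 <= b ^ 2) by (apply pow_incr; lra). lra.
      - assert ((- Re z') ^ 2 <= (- a) ^ 2) by (apply pow_incr; lra).
        replace ((- Re z') ^ 2) with (Re z' ^ 2) in * by ring.
        replace ((- a) ^ 2) with (a ^ 2) in * by ring. lra. }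
    assert (0 <= (h - Im z') * (h + Im z')) by (apply Rmult_le_pos; lra). lra. }
  destruct (rect_max a b (- h) h v) as (x0 & y0 & Hx0 & Hy0 & Hmax); [lra|lra| |].
  - intros x y Hx' Hy' e He.
    destruct (wiener_at_lipschitz g (x, y) (Hg (x, y) Hx' Hy')) as (r & L & Hr & HL & H).
    (* A local Lipschitz constant from above, for the sum metric, of [|g| + d |z|^2]. *)
    set (K := 2 * L + d * (2 * Rabs x + 2 * Rabs y + 2) + 1).
    pose proof (Rabs_pos x) as Px. pose proof (Rabs_pos y) as Py.
    assert (HK : 0 < K) by (unfold K; nra).
    exists (Rmin (Rmin 1 (r / 2)) (e / K)).
    assert (HeK : 0 < e / K) by (apply Rdiv_lt_0_compat; assumption).
    split; [apply Rmin_glb_lt; [apply Rmin_glb_lt; lra|exact HeK]|].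
    intros x' y' Hdx Hdy. set (t := Rmin _ _) in *.
    assert (t <= 1) by (eapply Rle_trans; [apply Rmin_l|apply Rmin_l]).
    assert (t <= r / 2) by (eapply Rle_trans; [apply Rmin_l|apply Rmin_r]).
    assert (Ht : t <= e / K) by apply Rmin_r.
    assert (t * K <= e).
    { replace e with (e / K * K) by (field; lra). apply Rmult_le_compat_r; lra. }
    set (p := x' - x) in *. set (q := y' - y) in *.
    pose proof (Cmod_pair_le p q) as Hpq.
    specialize (H (p, q)).
    replace ((x, y) + (p, q))%C with (x', y') in H
      by (unfold p, q, Cplus; simpl; f_equal; ring).
    assert (H' : Cmod (g (x', y')) <= Cmod (g (x, y)) + L * Cmod (p, q)) by (apply H; lra).
    unfold v. rewrite !Cmod2_alt. simpl Re. simpl Im.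
    replace (x' ^ 2 + y' ^ 2) with ((x + p) ^ 2 + (y + q) ^ 2) by (unfold p, q; ring).
    assert (Hsq : forall x p, Rabs p < t -> (x + p) ^ 2 <= x ^ 2 + (2 * Rabs x + 1) * t).
    { intros x1 p1 Hp1.
      assert (x1 * p1 <= Rabs x1 * t).
      { eapply Rle_trans; [apply Rle_abs|]. rewrite Rabs_mult.
        apply Rmult_le_compat_l; [apply Rabs_pos|lra]. }
      assert (p1 ^ 2 <= t).
      { rewrite <- pow2_abs. pose proof (Rabs_pos p1). nra. }
      nra. }
    pose proof (Hsq x p Hdx). pose proof (Hsq y q Hdy).
    assert (L * Cmod (p, q) <= L * (2 * t)) by (apply Rmult_le_compat_l; lra).
    assert (0 < t). { pose proof (Rabs_pos p). lra. }
    assert (d * ((x + p) ^ 2 + (y + q) ^ 2) <=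
      d * (x ^ 2 + y ^ 2) + d * (2 * Rabs x + 2 * Rabs y + 2) * t) by nra.
    unfold K in *. nra.
  - assert (Hv : v (Re z) (Im z) = Cmod (g z) + d * Cmod z ^ 2)
      by (unfold v; destruct z; reflexivity).
    assert (Hbig : B + d * Qm < v x0 y0).
    { pose proof (Hmax (Re z) (Im z) Hx Hy). rewrite Hv in H.
      assert (0 <= d * Cmod z ^ 2) by (apply Rmult_le_pos; [lra|apply pow2_ge_0]). lra. }
    assert (Hint : ~ (x0 = a \/ x0 = b \/ y0 = - h \/ y0 = h)).
    { intros Hbd. pose proof (HB (x0, y0) Hx0 Hy0 Hbd) as H1.
      pose proof (Hrect (x0, y0) Hx0 Hy0). unfold v in Hbig.
      assert (d * Cmod (x0, y0) ^ 2 <= d * Qm) by (apply Rmult_le_compat_l; lra). lra. }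
    assert (Hin : a < x0 < b /\ - h < y0 < h).
    { repeat split; apply Rnot_le_lt; intros Hle; apply Hint; lra. }
    destruct (wiener_at_no_local_max g (x0, y0) d
      (Rmin (Rmin (x0 - a) (b - x0)) (Rmin (y0 + h) (h - y0)))) as (w & Hw & Hw').
    + apply Hg; assumption.
    + exact Hd.
    + repeat apply Rmin_glb_lt; lra.
    + assert (Hm : forall a b c, a <= Rmin b c -> a <= b /\ a <= c).
      { intros r s t Hr. split; (eapply Rle_trans; [exact Hr|]); [apply Rmin_l|apply Rmin_r]. }
      destruct (Hm _ _ _ Hw) as [Hw1 Hw2].
      destruct (Hm _ _ _ Hw1) as [Hw3 Hw4]. destruct (Hm _ _ _ Hw2) as [Hw5 Hw6].
      pose proof (re_le_Cmod w) as Hre. pose proof (Rle_trans _ _ _ (Rmax_r _ _) (Rmax_Cmod w)) as Him.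
      apply Rabs_le_between in Hre. apply Rabs_le_between in Him.
      destruct w as [p q]. simpl in Hre, Him.
      specialize (Hmax (x0 + p) (y0 + q)). unfold v in Hmax.
      change ((x0, y0) + (p, q))%C with (x0 + p, y0 + q) in Hw'. lra.
Qed.

(** * The associated function *)

Lemma exp_le_compat x y : x <= y -> exp x <= exp y.
Proof. intros [H| ->]; [apply Rlt_le, exp_increasing, H|lra]. Qed.

Lemma ln_le_sub_1 x : 0 < x -> ln x <= x - 1.
Proof.
  intros Hx. pose proof (exp_ineq1_le (ln x)) as H. rewrite exp_ln in H by exact Hx. lra.
Qed.

Lemma assoc_fun_le (M : nat -> R) t B :
  0 < M O -> 0 <= B ->
  (0 < t -> forall p, ln (t ^ p * M O / M p) <= B) -> assoc_fun M t <= B.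
Proof.
  intros HM HB H. unfold assoc_fun. destruct (Rlt_dec 0 t) as [Ht|Ht]; [|exact HB].
  specialize (H Ht).
  pose proof (Sup_seq_correct (fun p => Finite (ln (t ^ p * M O / M p)))) as HS.
  destruct (Sup_seq (fun p => Finite (ln (t ^ p * M O / M p)))) as [l| |]; simpl in *.
  - apply Rnot_lt_le. intros Hlt.
    assert (He : 0 < l - B) by lra.
    destruct (HS (mkposreal _ He)) as [_ [n Hn]]. simpl in Hn. specialize (H n). lra.
  - exact HB.
  - exact HB.
Qed.

(** Since [M p / M (p - 1)] tends to infinity, the terms decrease as soon as that ratio
    exceeds [t]. This makes the supremum in [assoc_fun] finite. *)
Lemma assoc_fun_terms_bounded (M : nat -> R) t :
  (forall p, 0 < M p) ->
  is_lim_seq (fun p => M p / M (p - 1)%nat) p_infty ->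
  0 < t -> exists B, forall p, t ^ p * M O / M p <= B.
Proof.
  intros HM Hlim Ht.
  apply is_lim_seq_spec in Hlim. destruct (Hlim t) as [N HN].
  set (u := fun p => t ^ p * M O / M p).
  assert (Hu : forall p, 0 < u p).
  { intros p. apply Rdiv_lt_0_compat; [|apply HM].
    apply Rmult_lt_0_compat; [apply pow_lt, Ht|apply HM]. }
  assert (Hsum : forall p, (p <= N)%nat -> u p <= sum_f_R0 u N).
  { intros p Hp. apply Rle_trans with (sum_f_R0 u p).
    - destruct p; simpl; [lra|].
      assert (0 <= sum_f_R0 u p) by (apply cond_pos_sum; intros; apply Rlt_le, Hu). lra.
    - apply sum_f_R0_incr; [intros; apply Rlt_le, Hu|exact Hp]. }
  exists (sum_f_R0 u N). intros p. fold (u p).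
  destruct (Nat.le_ge_cases p N) as [Hp|Hp]; [apply Hsum, Hp|].
  induction Hp as [|m Hm IH]; [apply Hsum; lia|].
  apply Rle_trans with (u m); [|exact IH].
  specialize (HN (S m) ltac:(lia)). replace (S m - 1)%nat with m in HN by lia.
  unfold u. pose proof (HM m). pose proof (HM (S m)).
  assert (t * M m < M (S m)).
  { replace (M (S m)) with (M (S m) / M m * M m) by (field; lra).
    apply Rmult_lt_compat_r; assumption. }
  replace (t ^ S m * M O / M (S m)) with (t ^ m * M O / M m * (t * M m / M (S m)))
    by (simpl; field; lra).
  rewrite <- (Rmult_1_r (t ^ m * M O / M m)) at 2.
  apply Rmult_le_compat_l; [apply Rlt_le, (Hu m)|].
  apply Rmult_le_reg_r with (M (S m)); [assumption|].
  replace (t * M m / M (S m) * M (S m)) with (t * M m) by (field; lra). lra.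
Qed.

Lemma assoc_fun_ge (M : nat -> R) t :
  (forall p, 0 < M p) ->
  is_lim_seq (fun p => M p / M (p - 1)%nat) p_infty ->
  0 < t -> forall p, ln (t ^ p * M O / M p) <= assoc_fun M t.
Proof.
  intros HM Hlim Ht p.
  destruct (assoc_fun_terms_bounded M t HM Hlim Ht) as [B HB].
  assert (Hpos : forall n, 0 < t ^ n * M O / M n).
  { intros n. apply Rdiv_lt_0_compat; [|apply HM].
    apply Rmult_lt_0_compat; [apply pow_lt, Ht|apply HM]. }
  unfold assoc_fun. destruct (Rlt_dec 0 t) as [_|Hn]; [|contradiction].
  pose proof (Sup_seq_correct (fun p => Finite (ln (t ^ p * M O / M p)))) as HS.
  destruct (Sup_seq (fun p => Finite (ln (t ^ p * M O / M p)))) as [l| |]; simpl in *.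
  - apply Rnot_lt_le. intros Hlt.
    assert (He : 0 < ln (t ^ p * M O / M p) - l) by lra.
    destruct (HS (mkposreal _ He)) as [H _]. specialize (H p). simpl in H. lra.
  - destruct (HS B) as [n Hn]. simpl in Hn.
    pose proof (ln_le_sub_1 _ (Hpos n)). specialize (HB n). lra.
  - specialize (HS (ln (t ^ p * M O / M p)) p). lra.
Qed.

Lemma assoc_fun_nonneg (M : nat -> R) t :
  (forall p, 0 < M p) ->
  is_lim_seq (fun p => M p / M (p - 1)%nat) p_infty -> 0 <= assoc_fun M t.
Proof.
  intros HM Hlim. destruct (Rlt_dec 0 t) as [Ht|Ht].
  - pose proof (assoc_fun_ge M t HM Hlim Ht O) as H. simpl in H. pose proof (HM O).
    replace (1 * M O / M O) with 1 in H by (field; lra). rewrite ln_1 in H. exact H.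
  - unfold assoc_fun. destruct (Rlt_dec 0 t); [contradiction|lra].
Qed.

Lemma assoc_fun_incr (M : nat -> R) s t :
  (forall p, 0 < M p) ->
  is_lim_seq (fun p => M p / M (p - 1)%nat) p_infty ->
  s <= t -> assoc_fun M s <= assoc_fun M t.
Proof.
  intros HM Hlim Hst. apply assoc_fun_le; [apply HM|apply assoc_fun_nonneg; assumption|].
  intros Hs p. eapply Rle_trans; [|apply (assoc_fun_ge M t HM Hlim ltac:(lra) p)].
  pose proof (HM p). pose proof (HM O). pose proof (pow_lt s p Hs).
  apply ln_le.
  - apply Rdiv_lt_0_compat; [|assumption]. apply Rmult_lt_0_compat; assumption.
  - apply Rmult_le_compat_r; [apply Rlt_le, Rinv_0_lt_compat; assumption|].
    apply Rmult_le_compat_r; [lra|]. apply pow_incr. lra.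
Qed.

(** With [u = ln p] the hypothesis bounds the p-th term of the supremum by a constant plus
    [p ln (h t / u) <= e^u (h t - u) / u], and [h t - u <= e^(h t - u)] turns this
    into at most [e^(h t) / u]. *)
Lemma assoc_fun_upper (M : nat -> R) h B :
  (forall p, 0 < M p) -> 0 < h ->
  (forall p, (2 <= p)%nat -> ln (INR p) ^ p / (h ^ p * M p) <= B) ->
  exists B', 0 <= B' /\ forall t, assoc_fun M t <= B' + 2 * exp (h * t).
Proof.
  intros HM Hh HB. pose proof (HM O) as HM0. pose proof (HM 1%nat) as HM1.
  set (B0 := Rmax B 1).
  assert (HB0 : 0 < B0) by (pose proof (Rmax_r B 1); unfold B0; lra).
  set (c1 := ln (M O / (h * M 1%nat))). set (c2 := ln (M O * B0)).
  pose proof (Rabs_pos c1) as P1. pose proof (Rabs_pos c2) as P2.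
  pose proof (Rle_abs c1) as Q1. pose proof (Rle_abs c2) as Q2.
  exists (Rabs c1 + Rabs c2). split; [lra|]. intros t.
  pose proof (exp_pos (h * t)) as He.
  apply assoc_fun_le; [exact HM0|lra|]. intros Ht p.
  assert (Hht : 0 < h * t) by (apply Rmult_lt_0_compat; assumption).
  pose proof (exp_ineq1_le (h * t)) as He1.
  destruct p as [|[|p]].
  - simpl. replace (1 * M O / M O) with 1 by (field; lra). rewrite ln_1. lra.
  - replace (t ^ 1 * M O / M 1%nat) with ((h * t) * (M O / (h * M 1%nat))) by (field; lra).
    rewrite ln_mult; [|exact Hht|].
    + fold c1. pose proof (ln_le_sub_1 _ Hht). lra.
    + apply Rdiv_lt_0_compat; [lra|]. apply Rmult_lt_0_compat; assumption.
  - set (q := S (S p)). specialize (HB q ltac:(unfold q; lia)). pose proof (HM q) as HMq.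
    set (u := ln (INR q)) in *.
    assert (Hq2 : 2 <= INR q).
    { replace 2 with (INR 2) by (simpl; ring). apply le_INR. unfold q. lia. }
    assert (Hu : / 2 < u).
    { apply Rlt_le_trans with (ln 2); [apply ln_lt_2|]. apply ln_le; lra. }
    assert (Hup : 0 < u ^ q) by (apply pow_lt; lra).
    assert (Hhp : 0 < h ^ q) by (apply pow_lt; lra).
    assert (Htp : 0 < t ^ q) by (apply pow_lt; lra).
    assert (Hden : 0 < h ^ q * M q) by (apply Rmult_lt_0_compat; assumption).
    assert (HMB : u ^ q <= B0 * (h ^ q * M q)).
    { replace (u ^ q) with (u ^ q / (h ^ q * M q) * (h ^ q * M q)) by (field; lra).
      apply Rmult_le_compat_r; [lra|]. eapply Rle_trans; [exact HB|apply Rmax_l]. }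
    assert (Hstu : 0 < h * t / u) by (apply Rdiv_lt_0_compat; lra).
    assert (Hle : t ^ q * M O / M q <= M O * B0 * (h * t / u) ^ q).
    { unfold Rdiv at 2. rewrite !Rpow_mult_distr, pow_inv.
      apply Rmult_le_reg_r with (M q * u ^ q); [apply Rmult_lt_0_compat; assumption|].
      replace (t ^ q * M O / M q * (M q * u ^ q)) with (t ^ q * M O * u ^ q) by (field; lra).
      replace (M O * B0 * (h ^ q * t ^ q * / u ^ q) * (M q * u ^ q))
        with (t ^ q * M O * (B0 * (h ^ q * M q))) by (field; lra).
      apply Rmult_le_compat_l; [|exact HMB]. apply Rmult_le_pos; lra. }
    assert (Hpos : 0 < M O * B0) by (apply Rmult_lt_0_compat; assumption).
    eapply Rle_trans.
    { apply ln_le; [|exact Hle]. apply Rdiv_lt_0_compat; [|assumption].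
      apply Rmult_lt_0_compat; assumption. }
    rewrite ln_mult; [|exact Hpos|apply pow_lt, Hstu].
    fold c2. rewrite ln_pow by exact Hstu.
    assert (Hmain : INR q * ln (h * t / u) <= 2 * exp (h * t)); [|lra].
    pose proof (ln_le_sub_1 _ Hstu) as Hln.
    apply Rle_trans with (INR q * (h * t / u - 1)); [apply Rmult_le_compat_l; lra|].
    assert (Eq : INR q = exp u) by (unfold u; rewrite exp_ln; lra).
    pose proof (exp_ineq1_le (h * t - u)) as He2.
    assert (E3 : exp (h * t) = INR q * exp (h * t - u)).
    { rewrite Eq, <- exp_plus. f_equal. ring. }
    rewrite E3. replace (h * t / u - 1) with ((h * t - u) * / u) by (field; lra).
    assert (Hiu : 0 < / u < 2).
    { split; [apply Rinv_0_lt_compat; lra|]. rewrite <- (Rinv_inv 2). apply Rinv_lt_contravar; lra. }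
    replace (2 * (INR q * exp (h * t - u))) with (INR q * (2 * exp (h * t - u))) by ring.
    apply Rmult_le_compat_l; [lra|]. pose proof (exp_pos (h * t - u)).
    destruct (Rle_dec (h * t - u) 0); nra.
Qed.

(** Evaluate the p-th term of the supremum at [x = ln p / (2 mu)]. There the bound
    [K e^(mu x)] equals [K sqrt p], which is at most [K^2 + p]; the factor [e^p] is
    absorbed in the constant [h]. The value [ln p / mu] would lead to [e^(K p)] instead,
    and to an [h] depending on [K]. *)
Lemma log_growth_of_assoc_fun (M : nat -> R) (lambda mu K : R) :
  (forall p, 0 < M p) ->
  is_lim_seq (fun p => M p / M (p - 1)%nat) p_infty ->
  0 < lambda -> 0 < mu ->
  (forall x, 0 < x -> assoc_fun M (lambda * x) <= K * exp (mu * x)) ->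
  bound (fun y => exists p, (2 <= p)%nat /\
    y = ln (INR p) ^ p / ((2 * mu * exp 1 / lambda) ^ p * M p)).
Proof.
  intros HM Hlim Hl Hmu H. exists (exp (K ^ 2) / M O). intros y (p & Hp & ->).
  assert (Hp1 : 1 < INR p) by (apply (lt_INR 1); lia).
  assert (Hln : 0 < ln (INR p)) by (rewrite <- ln_1; apply ln_increasing; lra).
  set (x := ln (INR p) / (2 * mu)).
  assert (Hx : 0 < x) by (apply Rdiv_lt_0_compat; lra).
  assert (Hlx : 0 < lambda * x) by (apply Rmult_lt_0_compat; assumption).
  pose proof (assoc_fun_ge M (lambda * x) HM Hlim Hlx p) as H1.
  pose proof (H x Hx) as H2.
  set (s := exp (mu * x)) in *.
  assert (Hs : s ^ 2 = INR p).
  { unfold s. simpl. rewrite Rmult_1_r, <- exp_plus.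
    replace (mu * x + mu * x) with (ln (INR p)) by (unfold x; field; lra).
    apply exp_ln. lra. }
  pose proof (HM p) as HMp. pose proof (HM O) as HM0.
  assert (Hpw : 0 < (lambda * x) ^ p) by (apply pow_lt, Hlx).
  assert (H3 : (lambda * x) ^ p * M O / M p <= exp (K ^ 2) * exp 1 ^ p).
  { assert (Hq : 0 < (lambda * x) ^ p * M O / M p).
    { apply Rdiv_lt_0_compat; [apply Rmult_lt_0_compat|]; assumption. }
    rewrite <- (exp_ln _ Hq).
    replace (exp 1 ^ p) with (exp (INR p)).
    - rewrite <- exp_plus. apply exp_le_compat. rewrite <- Hs. pose proof (pow2_ge_0 (K - s)).
      assert (0 <= K ^ 2 + s ^ 2) by (pose proof (pow2_ge_0 K); pose proof (pow2_ge_0 s); lra).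
      nra.
    - clear. induction p; [simpl; rewrite exp_0; reflexivity|].
      rewrite S_INR, exp_plus, IHp. simpl. ring. }
  replace (ln (INR p)) with (lambda * x * (2 * mu / lambda)) by (unfold x; field; lra).
  replace (2 * mu * exp 1 / lambda) with (exp 1 * (2 * mu / lambda)) by (field; lra).
  rewrite (Rpow_mult_distr (lambda * x)), (Rpow_mult_distr (exp 1)).
  assert (Hc : 0 < (2 * mu / lambda) ^ p).
  { apply pow_lt, Rdiv_lt_0_compat; lra. }
  assert (He : 0 < exp 1 ^ p) by (apply pow_lt, exp_pos).
  replace ((lambda * x) ^ p * (2 * mu / lambda) ^ p / (exp 1 ^ p * (2 * mu / lambda) ^ p * M p))
    with ((lambda * x) ^ p * M O / M p * (/ (exp 1 ^ p * M O))) by (field; lra).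
  replace (exp (K ^ 2) / M O) with (exp (K ^ 2) * exp 1 ^ p * (/ (exp 1 ^ p * M O))) by (field; lra).
  apply Rmult_le_compat_r; [|exact H3].
  apply Rlt_le, Rinv_0_lt_compat, Rmult_lt_0_compat; assumption.
Qed.

(** * Decay on a strip bounds the associated function *)

Definition csinh (z : C) : C := (/ 2 * (cexp z - cexp (- z)))%C.

Lemma Re_csinh z : Re (csinh z) = sinh (Re z) * cos (Im z).
Proof.
  unfold csinh, cexp, sinh. rewrite <- RtoC_inv by lra.
  destruct z as [x y]. unfold Cminus, Copp, Cplus, Cmult, RtoC, Re, Im. simpl.
  rewrite cos_neg. field.
Qed.

Lemma wiener_at_csinh f z0 : wiener_at f z0 -> wiener_at (fun z => csinh (f z)) z0.
Proof.
  intros Hf. unfold csinh. apply wiener_at_mult; [apply wiener_at_const|].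
  apply wiener_at_minus; apply wiener_at_cexp; [|apply wiener_at_opp]; exact Hf.
Qed.

Lemma sinh_pos x : 0 < x -> 0 < sinh x.
Proof. intros Hx. rewrite <- sinh_0. apply sinh_lt, Hx. Qed.

Lemma sinh_le_exp x : 0 <= x -> sinh x <= exp x.
Proof. intros Hx. unfold sinh. pose proof (exp_pos x). pose proof (exp_pos (- x)). lra. Qed.

(** A two-constants argument: [sinh (mu (x - x1)) cos (mu y)] is a positive harmonic function
    on the half-strip [Re z > x1], [|Im z| < h'], zero on its boundary, and it grows like
    [e^(mu x)]. *)
Lemma assoc_fun_exp_bound (M : nat -> R) (f : C -> C) (h h' lambda : R) (z0 : C) :
  (forall p, 0 < M p) ->
  is_lim_seq (fun p => M p / M (p - 1)%nat) p_infty ->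
  0 < lambda -> Rabs (Im z0) < h' -> h' < h ->
  (forall z, strip h z -> wiener_at f z) ->
  f z0 <> 0 ->
  decay_bound M h lambda f ->
  exists K, forall x, 0 < x -> assoc_fun M (lambda * x) <= K * exp (PI / (2 * h') * x).
Proof.
  intros HM Hlim Hl Hz0 Hh Hf Hfz0 [C0 HC0].
  assert (HC : forall z, strip h z ->
    Cmod (f z) * exp (assoc_fun M (lambda * Rabs (Re z))) <= C0).
  { intros z Hz. apply HC0. exists z. auto. }
  assert (Hh' : 0 < h') by (pose proof (Rabs_pos (Im z0)); lra).
  set (mu := PI / (2 * h')). pose proof PI_RGT_0 as Hpi.
  assert (Hmu : 0 < mu) by (apply Rdiv_lt_0_compat; lra).
  assert (Hmuh : mu * h' = PI / 2) by (unfold mu; field; lra).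
  assert (Hstrip : forall z, - h' <= Im z <= h' -> strip h z).
  { intros z Hz. unfold strip. apply Rabs_def1; lra. }
  assert (HC1 : forall z, strip h z -> Cmod (f z) <= C0).
  { intros z Hz. eapply Rle_trans; [|apply (HC z Hz)].
    rewrite <- (Rmult_1_r (Cmod (f z))) at 1. apply Rmult_le_compat_l; [apply Cmod_ge_0|].
    rewrite <- exp_0. apply exp_le_compat, assoc_fun_nonneg; assumption. }
  set (x0 := Re z0) in *. set (y0 := Im z0) in *. set (x1 := x0 - 1).
  apply Rabs_def2 in Hz0.
  assert (Hf0 : 0 < Cmod (f z0)) by (apply Cmod_gt_0; exact Hfz0).
  assert (HC0pos : 0 < C0).
  { pose proof (HC1 z0). assert (strip h z0) by (apply Hstrip; fold y0; lra). specialize (H H0). lra. }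
  assert (Hcos0 : 0 < cos (mu * y0)).
  { apply cos_gt_0; nra. }
  set (kappa := ln (C0 / Cmod (f z0))).
  set (A := sinh mu * cos (mu * y0)).
  assert (HA : 0 < A) by (apply Rmult_lt_0_compat; [apply sinh_pos|]; assumption).
  set (X := Rabs x0 + 1).
  assert (HX : 0 < X /\ x0 < X).
  { pose proof (Rabs_pos x0). pose proof (Rle_abs x0). unfold X. lra. }
  set (K := Rabs kappa / A * exp (- (mu * x1))).
  assert (HK : 0 <= K).
  { apply Rmult_le_pos; [|apply Rlt_le, exp_pos].
    apply Rmult_le_pos; [apply Rabs_pos|apply Rlt_le, Rinv_0_lt_compat, HA]. }
  assert (Hbig : forall x, X <= x -> assoc_fun M (lambda * x) <= K * exp (mu * x)).
  { intros x Hx. set (m := assoc_fun M (lambda * x)).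
    assert (Hm : 0 <= m) by (apply assoc_fun_nonneg; assumption).
    assert (Hsx : 0 < sinh (mu * (x - x1))) by (apply sinh_pos; unfold x1; nra).
    (* With this [a] the exponent has real part at most [m] on the side [Re z = x]. *)
    set (a := m / sinh (mu * (x - x1))).
    assert (Ha : 0 <= a).
    { apply Rmult_le_pos; [exact Hm|apply Rlt_le, Rinv_0_lt_compat, Hsx]. }
    set (s := fun z : C => (a * csinh (mu * (z - x1)))%C).
    assert (Hs : forall z, Re (s z) = a * (sinh (mu * (Re z - x1)) * cos (mu * Im z))).
    { intros z. unfold s.
      replace (Re (a * csinh (mu * (z - x1)))%C) with (a * Re (csinh (mu * (z - x1)))%C)
        by (simpl; ring).
      rewrite Re_csinh. destruct z as [p q]. simpl. f_equal. f_equal; f_equal; ring. }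
    assert (Hmax : Cmod (f z0 * cexp (s z0))%C <= C0).
    { apply (max_modulus_rect (fun z => f z * cexp (s z))%C x1 x h' C0).
      - unfold x1. lra.
      - lra.
      - intros z _ Hz. apply wiener_at_mult; [apply Hf, Hstrip, Hz|].
        apply wiener_at_cexp. unfold s. apply wiener_at_mult; [apply wiener_at_const|].
        apply wiener_at_csinh. apply wiener_at_mult; [apply wiener_at_const|].
        apply wiener_at_minus; [apply wiener_at_id|apply wiener_at_const].
      - intros z Hzx Hzy Hbd. rewrite Cmod_mult, Cmod_cexp, Hs.
        specialize (Hstrip z Hzy).
        assert (H0 : forall e, e = 0 -> Cmod (f z) * exp e <= C0).
        { intros e ->. rewrite exp_0, Rmult_1_r. apply HC1, Hstrip. }
        destruct Hbd as [E|[E|[E|E]]].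
        + apply H0. rewrite E. replace (mu * (x1 - x1)) with 0 by ring. rewrite sinh_0. ring.
        + eapply Rle_trans; [|apply (HC z Hstrip)].
          apply Rmult_le_compat_l; [apply Cmod_ge_0|]. apply exp_le_compat.
          rewrite E, (Rabs_pos_eq x) by lra. fold m.
          replace m with (a * sinh (mu * (x - x1))) by (unfold a; field; lra).
          rewrite <- Rmult_assoc. rewrite <- (Rmult_1_r (a * _)) at 2.
          apply Rmult_le_compat_l; [apply Rmult_le_pos; lra|apply COS_bound].
        + apply H0. rewrite E. replace (mu * - h') with (- (PI / 2)) by lra.
          rewrite cos_neg, cos_PI2. ring.
        + apply H0. rewrite E, Hmuh, cos_PI2. ring.
      - fold x0. unfold x1. lra.
      - fold y0. lra. }
    rewrite Cmod_mult, Cmod_cexp, Hs in Hmax. fold x0 y0 in Hmax.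
    replace (x0 - x1) with 1 in Hmax by (unfold x1; ring). rewrite Rmult_1_r in Hmax.
    fold A in Hmax.
    assert (HaA : a * A <= Rabs kappa).
    { apply Rle_trans with kappa; [|apply Rle_abs].
      unfold kappa. rewrite <- (ln_exp (a * A)). apply ln_le; [apply exp_pos|].
      apply Rmult_le_reg_l with (Cmod (f z0)); [exact Hf0|].
      replace (Cmod (f z0) * (C0 / Cmod (f z0))) with C0 by (field; lra). exact Hmax. }
    replace m with (a * sinh (mu * (x - x1))) by (unfold a; field; lra).
    assert (Ha' : a <= Rabs kappa / A).
    { apply Rmult_le_reg_r with A; [exact HA|].
      replace (Rabs kappa / A * A) with (Rabs kappa) by (field; lra). exact HaA. }
    unfold K. rewrite Rmult_assoc, <- exp_plus.
    replace (- (mu * x1) + mu * x) with (mu * (x - x1)) by ring.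
    apply Rmult_le_compat; [exact Ha|lra|exact Ha'|].
    apply sinh_le_exp. unfold x1. nra. }
  exists (K * exp (mu * X)). intros x Hx.
  assert (Hex : forall t, 0 < t -> 1 <= exp (mu * t)).
  { intros t Ht. rewrite <- exp_0. apply exp_le_compat. nra. }
  destruct (Rle_dec X x) as [HXx|HXx].
  - eapply Rle_trans; [apply (Hbig x HXx)|].
    apply Rmult_le_compat_r; [apply Rlt_le, exp_pos|].
    specialize (Hex X (proj1 HX)). nra.
  - apply Rle_trans with (assoc_fun M (lambda * X)).
    + apply assoc_fun_incr; [assumption|assumption|]. apply Rmult_le_compat_l; lra.
    + eapply Rle_trans; [apply (Hbig X (Rle_refl X))|].
      specialize (Hex x Hx). assert (0 <= K * exp (mu * X)).
      { apply Rmult_le_pos; [exact HK|apply Rlt_le, exp_pos]. } nra.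
Qed.

(** * An entire function that is large on horizontal strips *)

(** A converse of Bernoulli's inequality, valid for small [n u]. *)
Lemma pow_1_plus_le u n : 0 <= u -> 3 * INR n * u <= 1 -> (1 + u) ^ n <= 1 + 3 / 2 * INR n * u.
Proof.
  intros Hu. induction n; intros H; [simpl; lra|].
  rewrite S_INR in *. pose proof (pos_INR n).
  assert (IH : (1 + u) ^ n <= 1 + 3 / 2 * INR n * u) by (apply IHn; nra).
  simpl. apply Rle_trans with ((1 + u) * (1 + 3 / 2 * INR n * u)).
  - apply Rmult_le_compat_l; lra.
  - assert (0 <= u * (1 - 3 * INR n * u)) by (apply Rmult_le_pos; nra). nra.
Qed.

(** The binomial expansion of [(a + d)^n - a^n] has nonnegative coefficients, so that its
    modulus is largest for nonnegative [a] and [d]. *)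
Lemma Cmod_pow_minus_le (z a : C) n :
  Cmod (z ^ n - a ^ n)%C <= (Cmod a + Cmod (z - a)%C) ^ n - Cmod a ^ n.
Proof.
  pose proof (Cmod_ge_0 a) as Pa. pose proof (Cmod_ge_0 (z - a)%C) as Pd.
  induction n; simpl.
  - replace (1 - 1)%C with (RtoC 0) by ring. rewrite Cmod_0. lra.
  - replace (z * z ^ n - a * a ^ n)%C with (z * (z ^ n - a ^ n) + (z - a) * a ^ n)%C by ring.
    eapply Rle_trans; [apply Cmod_triangle|]. rewrite !Cmod_mult, Cmod_pow.
    pose proof (Cmod_le_sub z a) as Hz.
    pose proof (Cmod_ge_0 (z ^ n - a ^ n)%C) as P.
    assert (Cmod z * Cmod (z ^ n - a ^ n)%C <= (Cmod a + Cmod (z - a)%C) *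
      ((Cmod a + Cmod (z - a)%C) ^ n - Cmod a ^ n)).
    { apply Rmult_le_compat; [apply Cmod_ge_0|exact P|exact Hz|exact IHn]. }
    lra.
Qed.

(** The point [z] is close to [Re z] relative to its size: [(1 + h / x)^(2 i) <= 3 / 2]
    for [x = |Re z|], whence [|z^(2 i) - x^(2 i)| <= x^(2 i) / 2]. *)
Lemma Re_even_pow_ge (z : C) h i :
  0 < Rabs (Re z) -> Rabs (Im z) <= h -> 6 * INR i * h <= Rabs (Re z) ->
  / 2 * Rabs (Re z) ^ (2 * i) <= Re (z ^ (2 * i))%C.
Proof.
  intros Hx Hy Hi. set (x := Rabs (Re z)) in *.
  assert (Hh : 0 <= h) by (pose proof (Rabs_pos (Im z)); lra).
  pose proof (Cmod_pow_minus_le z (Re z) (2 * i)) as H.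
  replace (z - Re z)%C with (Ci * Im z)%C in H
    by (destruct z; unfold Cminus, Cplus, Copp, Cmult, Ci, RtoC; simpl; f_equal; ring).
  rewrite Cmod_mult, Cmod_Ci, !Cmod_R, Rmult_1_l in H. fold x in H.
  pose proof (re_le_Cmod (z ^ (2 * i) - (Re z) ^ (2 * i))%C) as Hre.
  rewrite <- RtoC_pow in H, Hre.
  replace (Re (z ^ (2 * i) - RtoC (Re z ^ (2 * i)))%C)
    with (Re (z ^ (2 * i))%C - Re z ^ (2 * i)) in Hre by reflexivity.
  replace (Re z ^ (2 * i)) with (x ^ (2 * i)) in H, Hre
    by (unfold x; rewrite !pow_mult, pow2_abs; reflexivity).
  apply Rabs_le_between in Hre.
  assert (Hpow : (x + Rabs (Im z)) ^ (2 * i) <= 3 / 2 * x ^ (2 * i)).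
  { apply Rle_trans with ((x * (1 + h / x)) ^ (2 * i)).
    - apply pow_incr. pose proof (Rabs_pos (Im z)).
      replace (x * (1 + h / x)) with (x + h) by (field; lra). lra.
    - rewrite Rpow_mult_distr, Rmult_comm. apply Rmult_le_compat_r; [apply pow_le; lra|].
      assert (Hhx : 0 <= h / x) by (apply Rmult_le_pos; [lra|apply Rlt_le, Rinv_0_lt_compat, Hx]).
      assert (H3 : 3 * INR (2 * i) * (h / x) <= 1).
      { rewrite mult_INR. simpl (INR 2). apply Rmult_le_reg_r with x; [exact Hx|].
        replace (3 * ((1 + 1) * INR i) * (h / x) * x) with (6 * INR i * h) by (field; lra). lra. }
      pose proof (pow_1_plus_le (h / x) (2 * i) Hhx H3). lra. }
  lra.
Qed.

(** The scales [(j + 1) N_j] are chosen so that the j-th term is at most [2^(-j)] as long as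
    [|z|] is at most [(j + 1) N_j / 2]. *)
Definition entire_term (N : nat -> R) (j : nat) (z : C) : C :=
  ((RtoC (/ (INR (S j) * N j)) * z) ^ (2 * j))%C.

Lemma scale_pos (N : nat -> R) (N_ge_1 : forall j, 1 <= N j) j : 0 < INR (S j) * N j.
Proof.
  specialize (N_ge_1 j). apply Rmult_lt_0_compat; [apply lt_0_INR; lia|lra].
Qed.

Lemma Cmod_entire_term (N : nat -> R) (N_ge_1 : forall j, 1 <= N j) j z : Cmod (entire_term N j z) = (/ (INR (S j) * N j) * Cmod z) ^ (2 * j).
Proof.
  unfold entire_term. rewrite Cmod_pow, Cmod_mult, Cmod_R, Rabs_pos_eq; [reflexivity|].
  apply Rlt_le, Rinv_0_lt_compat, scale_pos, N_ge_1.
Qed.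

Lemma pow_even_le_half_pow x j : 0 <= x <= 1 / 2 -> x ^ (2 * j) <= (1 / 2) ^ j.
Proof.
  intros Hx. rewrite pow_mult. apply pow_incr. split; [apply pow2_ge_0|].
  simpl. nra.
Qed.

Lemma sum_bounded_of_tail (b : nat -> R) J :
  (forall j, 0 <= b j) -> (forall j, (J <= j)%nat -> b j <= (1 / 2) ^ j) ->
  exists B, forall n, sum_f_R0 b n <= B.
Proof.
  intros Hb HJ. exists (sum_f_R0 b J + 2). intros n.
  apply Rle_trans with (sum_f_R0 b J + sum_f_R0 (fun k => (1 / 2) ^ k) n).
  - destruct (Nat.le_ge_cases n J) as [H|H].
    + pose proof (sum_f_R0_incr b n J Hb H).
      assert (0 <= sum_f_R0 (fun k => (1 / 2) ^ k) n)
        by (apply cond_pos_sum; intros; apply pow_le; lra). lra.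
    + induction H as [|m Hm IH].
      * assert (0 <= sum_f_R0 (fun k => (1 / 2) ^ k) J)
        by (apply cond_pos_sum; intros; apply pow_le; lra). lra.
      * rewrite !tech5. specialize (HJ (S m) ltac:(lia)). lra.
  - pose proof (sum_geom_half_le n). lra.
Qed.

Lemma entire_term_sum_bounded (N : nat -> R) (N_ge_1 : forall j, 1 <= N j) rho :
  0 <= rho -> exists B, forall n,
    sum_f_R0 (fun j => (/ (INR (S j) * N j) * rho) ^ (2 * j)) n <= B.
Proof.
  intros Hrho. destruct (INR_unbounded (2 * rho)) as [J HJ].
  assert (Hx : forall j, 0 <= / (INR (S j) * N j) * rho).
  { intros j. apply Rmult_le_pos; [apply Rlt_le, Rinv_0_lt_compat, scale_pos, N_ge_1|exact Hrho]. }
  apply sum_bounded_of_tail with J.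
  - intros j. apply pow_le, Hx.
  - intros j Hj. apply pow_even_le_half_pow. split; [apply Hx|].
    pose proof (scale_pos N N_ge_1 j) as Hs.
    apply Rmult_le_reg_l with (INR (S j) * N j); [exact Hs|].
    rewrite <- Rmult_assoc, Rinv_r, Rmult_1_l by lra.
    assert (INR J <= INR (S j)) by (apply le_INR; lia).
    specialize (N_ge_1 j). nra.
Qed.

Lemma entire_sum_ex (N : nat -> R) (N_ge_1 : forall j, 1 <= N j) : exists G : C -> C, forall z, cseries (fun j => entire_term N j z) (G z).
Proof.
  apply (functional_choice (fun z l => cseries (fun j => entire_term N j z) l)). intros z.
  destruct (entire_term_sum_bounded N N_ge_1 (Cmod z) (Cmod_ge_0 z)) as [B HB].
  apply cseries_abs_ex with B. intros n. eapply Rle_trans; [|apply (HB n)].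
  apply sum_Rle. intros j _. rewrite Cmod_entire_term by exact N_ge_1. lra.
Qed.

Lemma wiener_at_entire (N : nat -> R) (N_ge_1 : forall j, 1 <= N j)
    (G : C -> C) (HG : forall z, cseries (fun j => entire_term N j z) (G z)) z0 : wiener_at G z0.
Proof.
  assert (Hr : 0 <= Cmod z0 + 1) by (pose proof (Cmod_ge_0 z0); lra).
  destruct (entire_term_sum_bounded N N_ge_1 _ Hr) as [B HB].
  exists 1, B. split; [lra|].
  apply (wiener_series 1 (fun j w => entire_term N j (z0 + w)%C)
    (fun j => (/ (INR (S j) * N j) * (Cmod z0 + 1)) ^ (2 * j))); [lra| |exact HB|intros; apply HG].
  intros j.
  apply (wiener_pow 1 (fun w => RtoC (/ (INR (S j) * N j)) * (z0 + w))%C); [lra|].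
  apply wiener_le with (Cmod (RtoC (/ (INR (S j) * N j))) * (Cmod z0 + 1)).
  - rewrite Cmod_R, Rabs_pos_eq; [lra|]. apply Rlt_le, Rinv_0_lt_compat, scale_pos, N_ge_1.
  - apply wiener_scal, wiener_translate. lra.
Qed.

Lemma entire_bounded (N : nat -> R) (N_ge_1 : forall j, 1 <= N j)
    (G : C -> C) (HG : forall z, cseries (fun j => entire_term N j z) (G z)) rho : 0 <= rho -> exists B, forall z, Cmod z <= rho -> Cmod (G z) <= B.
Proof.
  intros Hrho. destruct (entire_term_sum_bounded N N_ge_1 rho Hrho) as [B HB].
  exists B. intros z Hz. apply (cseries_Cmod_le _ _ _ (HG z)). intros n.
  eapply Rle_trans; [apply Cmod_csum|]. eapply Rle_trans; [|apply (HB n)].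
  apply sum_Rle. intros j _. rewrite Cmod_entire_term by exact N_ge_1. apply pow_incr.
  pose proof (Rinv_0_lt_compat _ (scale_pos N N_ge_1 j)). pose proof (Cmod_ge_0 z).
  split; [apply Rmult_le_pos; lra|]. apply Rmult_le_compat_l; lra.
Qed.

(** [Re_even_pow_ge] is invariant under scaling. *)
Lemma Re_entire_term_main (N : nat -> R) (N_ge_1 : forall j, 1 <= N j) h i z :
  0 < Rabs (Re z) -> Rabs (Im z) <= h -> 6 * INR i * h <= Rabs (Re z) ->
  / 2 * (Rabs (Re z) / (INR (S i) * N i)) ^ (2 * i) <= Re (entire_term N i z).
Proof.
  intros Hx Hy Hi. unfold entire_term. set (s := / (INR (S i) * N i)).
  assert (Hs : 0 < s) by (apply Rinv_0_lt_compat, scale_pos, N_ge_1).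
  assert (E1 : Re (RtoC s * z)%C = s * Re z)
    by (clearbody s; destruct z; unfold Cmult, RtoC, Re, Im; simpl; ring).
  assert (E2 : Im (RtoC s * z)%C = s * Im z)
    by (clearbody s; destruct z; unfold Cmult, RtoC, Re, Im; simpl; ring).
  pose proof (Re_even_pow_ge (RtoC s * z)%C (s * h) i) as H.
  rewrite E1, E2, !Rabs_mult, (Rabs_pos_eq s) in H by lra.
  unfold Rdiv. fold s. rewrite (Rmult_comm _ s). apply H.
  - apply Rmult_lt_0_compat; assumption.
  - apply Rmult_le_compat_l; lra.
  - nra.
Qed.

(** Here [|z| <= 6 i h + h <= 7 h (i + 1)], which is at most half of the scale
    [(i + 1) N_i]. *)
Lemma Re_entire_term_tail (N : nat -> R) (N_ge_1 : forall j, 1 <= N j) h i z :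
  Rabs (Im z) <= h -> Rabs (Re z) < 6 * INR i * h -> 14 * h <= N i ->
  - (1 / 2) ^ i <= Re (entire_term N i z).
Proof.
  intros Hy Hx HN.
  pose proof (re_le_Cmod (entire_term N i z)) as H. rewrite Cmod_entire_term in H by exact N_ge_1.
  apply Rabs_le_between in H.
  assert ((/ (INR (S i) * N i) * Cmod z) ^ (2 * i) <= (1 / 2) ^ i); [|lra].
  pose proof (scale_pos N N_ge_1 i) as Hs. pose proof (Cmod_ge_0 z).
  apply pow_even_le_half_pow. split.
  - apply Rmult_le_pos; [apply Rlt_le, Rinv_0_lt_compat, Hs|assumption].
  - apply Rmult_le_reg_l with (INR (S i) * N i); [exact Hs|].
    rewrite <- Rmult_assoc, Rinv_r, Rmult_1_l by lra.
    pose proof (Cmod_pair_le (Re z) (Im z)) as Hz. replace (Re z, Im z) with z in Hz by (destruct z; reflexivity).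
    rewrite S_INR in *. pose proof (pos_INR i).
    assert (0 <= h) by (pose proof (Rabs_pos (Im z)); lra).
    assert ((INR i + 1) * (14 * h) <= (INR i + 1) * N i) by (apply Rmult_le_compat_l; lra).
    lra.
Qed.

(** No main term has a negative real part, and the terms in the tail together contribute at
    least [-2] to the real part. The condition involving [J] keeps the indices for which
    [N] is still too small out of the tail. *)
Lemma Re_entire_ge (N : nat -> R) (N_ge_1 : forall j, 1 <= N j)
    (G : C -> C) (HG : forall z, cseries (fun j => entire_term N j z) (G z)) h J j z :
  0 < h -> (forall i, (J <= i)%nat -> 14 * h <= N i) ->
  Rabs (Im z) <= h -> 6 * INR (S J) * h <= Rabs (Re z) -> 6 * INR j * h <= Rabs (Re z) ->
  / 2 * (Rabs (Re z) / (INR (S j) * N j)) ^ (2 * j) - 2 <= Re (G z).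
Proof.
  intros Hh HN Hy HJ Hj. set (x := Rabs (Re z)) in *.
  assert (Hx : 0 < x).
  { eapply Rlt_le_trans; [|exact HJ]. assert (0 < INR (S J)) by (apply lt_0_INR; lia). nra. }
  set (T := / 2 * (x / (INR (S j) * N j)) ^ (2 * j)).
  assert (Hterm : forall i, - (1 / 2) ^ i <= Re (entire_term N i z)).
  { intros i. destruct (Rle_dec (6 * INR i * h) x) as [Hi|Hi].
    - pose proof (Re_entire_term_main N N_ge_1 h i z Hx Hy Hi).
      assert (0 <= (x / (INR (S i) * N i)) ^ (2 * i)).
      { apply pow_le, Rmult_le_pos; [lra|]. apply Rlt_le, Rinv_0_lt_compat, scale_pos, N_ge_1. }
      assert (0 < (1 / 2) ^ i) by (apply pow_lt; lra). fold x in H. lra.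
    - apply Re_entire_term_tail with h; [exact N_ge_1|exact Hy|fold x; lra|]. apply HN.
      assert (S J < i)%nat; [|lia]. apply INR_lt. apply Rnot_le_lt. intros Hle. apply Hi.
      eapply Rle_trans; [|exact HJ]. apply Rmult_le_compat_r; lra. }
  assert (HT : T <= Re (entire_term N j z)) by (apply Re_entire_term_main with h; assumption).
  assert (Hpart0 : forall n, - sum_f_R0 (fun k => (1 / 2) ^ k) n <= Re (csum (fun i => entire_term N i z) n)).
  { intros n. rewrite Re_csum. induction n; simpl.
    - specialize (Hterm O). simpl in Hterm. exact Hterm.
    - specialize (Hterm (S n)). simpl in Hterm. lra. }
  assert (Hpart : forall n, (j <= n)%nat ->
    T - sum_f_R0 (fun k => (1 / 2) ^ k) n <= Re (csum (fun i => entire_term N i z) n)).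
  { intros n Hn. induction Hn as [|m Hm IH].
    - destruct j as [|k].
      + simpl sum_f_R0. simpl csum. lra.
      + specialize (Hpart0 k). rewrite tech5.
        assert (0 < (1 / 2) ^ S k) by (apply pow_lt; lra).
        change (csum (fun i => entire_term N i z) (S k)) with
          (csum (fun i => entire_term N i z) k + entire_term N (S k) z)%C.
        assert (E : forall a b, Re (a + b)%C = Re a + Re b) by reflexivity. rewrite E. lra.
    - rewrite tech5. specialize (Hterm (S m)).
      change (csum (fun i => entire_term N i z) (S m)) with
          (csum (fun i => entire_term N i z) m + entire_term N (S m) z)%C.
      assert (E : forall a b, Re (a + b)%C = Re a + Re b) by reflexivity. rewrite E. lra. }
  apply Rnot_lt_le. intros Hlt.
  destruct (proj1 (cseries_eps _ _) (HG z) (T - 2 - Re (G z))) as [n0 Hn0]; [lra|].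
  specialize (Hn0 (max n0 j) (Nat.le_max_l _ _)). specialize (Hpart (max n0 j) (Nat.le_max_r _ _)).
  pose proof (sum_geom_half_le (max n0 j)).
  pose proof (re_le_Cmod (csum (fun i => entire_term N i z) (max n0 j) - G z)%C) as Hre.
  assert (E : forall a b, Re (a - b)%C = Re a - Re b) by reflexivity. rewrite E in Hre.
  apply Rabs_le_between in Hre. lra.
Qed.

(** Far out the bound comes from [Re_entire_ge]; on the remaining bounded part of the strip
    all quantities are bounded. *)
Lemma decay_bound_entire (N : nat -> R) (N_ge_1 : forall j, 1 <= N j)
    (G : C -> C) (HG : forall z, cseries (fun j => entire_term N j z) (G z)) (M : nat -> R) h lambda J X K :
  (forall p, 0 < M p) ->
  is_lim_seq (fun p => M p / M (p - 1)%nat) p_infty ->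
  0 < h -> 0 < lambda ->
  (forall i, (J <= i)%nat -> 14 * h <= N i) ->
  (forall x, X <= x -> exists j, 6 * INR j * h <= x /\
     assoc_fun M (lambda * x) <= / 2 * (x / (INR (S j) * N j)) ^ (2 * j) + K) ->
  decay_bound M h lambda (fun z => cexp (- G z)).
Proof.
  intros HM Hlim Hh Hl HN Hgrow.
  set (X' := Rmax X (6 * INR (S J) * h)).
  assert (HX' : 0 <= X').
  { eapply Rle_trans; [|apply Rmax_r]. pose proof (pos_INR (S J)). nra. }
  destruct (entire_bounded N N_ge_1 G HG (X' + h)) as [B HB]; [lra|].
  exists (exp (2 + K) + exp (B + assoc_fun M (lambda * X'))).
  intros y (z & Hz & ->). unfold strip in Hz. rewrite Cmod_cexp, <- exp_plus.
  assert (E : forall a, Re (- a)%C = - Re a) by reflexivity. rewrite E.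
  pose proof (exp_pos (2 + K)). pose proof (exp_pos (B + assoc_fun M (lambda * X'))).
  destruct (Rle_dec X' (Rabs (Re z))) as [Hx|Hx].
  - destruct (Hgrow (Rabs (Re z))) as (j & Hj & HjK).
    { eapply Rle_trans; [apply Rmax_l|exact Hx]. }
    assert (HJ : 6 * INR (S J) * h <= Rabs (Re z)).
    { eapply Rle_trans; [apply Rmax_r|exact Hx]. }
    pose proof (Re_entire_ge N N_ge_1 G HG h J j z Hh HN (Rlt_le _ _ Hz) HJ Hj).
    assert (exp (- Re (G z) + assoc_fun M (lambda * Rabs (Re z))) <= exp (2 + K)); [|lra].
    apply exp_le_compat. lra.
  - assert (Hle : exp (- Re (G z) + assoc_fun M (lambda * Rabs (Re z))) <=
      exp (B + assoc_fun M (lambda * X'))); [|lra].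
    apply exp_le_compat. apply Rplus_le_compat.
    + pose proof (re_le_Cmod (G z)) as Hre. apply Rabs_le_between in Hre.
      assert (Cmod (G z) <= B); [|lra]. apply HB.
      pose proof (Cmod_pair_le (Re z) (Im z)) as Hz'.
      replace (Re z, Im z) with z in Hz' by (destruct z; reflexivity). lra.
    + apply assoc_fun_incr; [assumption|assumption|]. apply Rmult_le_compat_l; lra.
Qed.

Lemma level_crossing (a : nat -> R) x J n :
  a J <= x -> x < a (J + n)%nat -> exists j, (J <= j)%nat /\ a j <= x < a (S j).
Proof.
  intros HJ. induction n; intros Hn.
  - rewrite Nat.add_0_r in Hn. lra.
  - destruct (Rlt_dec x (a (J + n)%nat)) as [H|H]; [apply IHn, H|].
    exists (J + n)%nat. split; [lia|]. rewrite <- plus_n_Sm in Hn. lra.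
Qed.

(** The two inequalities on [x] say that its quotient by the scale of index [j] is at least
    [3 > e] and that [j] is at least [x / (3 N_(j+1)) - 2]. *)
Lemma entire_term_growth (N : nat -> R) x j :
  (forall j, 1 <= N j) ->
  3 * (INR (S j) * N j) <= x -> x < 3 * (INR (S (S j)) * N (S j)) ->
  exp (-4) * exp (x / (3 * N (S j))) ^ 2 <= (x / (INR (S j) * N j)) ^ (2 * j).
Proof.
  intros HN H1 H2. pose proof (HN (S j)) as HNj. pose proof (scale_pos N HN j) as Hs.
  apply Rle_trans with (exp 1 ^ (2 * j)).
  - assert (Ee : forall n, exp 1 ^ n = exp (INR n)).
    { induction n; [simpl; rewrite exp_0; reflexivity|].
      rewrite S_INR, exp_plus, <- IHn. simpl. ring. }
    rewrite Ee. simpl pow. rewrite Rmult_1_r, <- !exp_plus. apply exp_le_compat.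
    rewrite mult_INR. simpl (INR 2).
    assert (x / (3 * N (S j)) <= INR j + 2); [|lra].
    apply Rmult_le_reg_r with (3 * N (S j)); [lra|].
    replace (x / (3 * N (S j)) * (3 * N (S j))) with x by (field; lra).
    rewrite !S_INR in H2. lra.
  - apply pow_incr. split; [apply Rlt_le, exp_pos|].
    apply Rle_trans with 3; [apply exp_le_3|].
    apply Rmult_le_reg_r with (INR (S j) * N j); [exact Hs|].
    replace (x / (INR (S j) * N j) * (INR (S j) * N j)) with x; [exact H1|].
    assert (INR (S j) <> 0 /\ N j <> 0); [|field; tauto].
    split; [apply not_0_INR; lia|specialize (HN j); lra].
Qed.

(** The sequence advances by one step each time the threshold of its next value has passed. *)
Lemma slow_sequence (T : nat -> nat) :
  exists nu : nat -> nat,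
    forall m, exists J, forall j, (J <= j)%nat -> (m <= nu j)%nat /\ (T (nu j) <= j)%nat.
Proof.
  set (nu := fix nu j := match j with
    | O => O
    | S k => if Nat.leb (T (S (nu k))) (S k) then S (nu k) else nu k
    end).
  assert (Hinv : forall j, nu j = O \/ (T (nu j) <= j)%nat).
  { induction j; [left; reflexivity|]. simpl.
    destruct (Nat.leb_spec (T (S (nu j))) (S j)); [right; assumption|].
    destruct IHj as [H0|H0]; [left; exact H0|right; lia]. }
  assert (Hstep : forall j, (nu j <= nu (S j))%nat).
  { intros j. simpl. destruct (Nat.leb (T (S (nu j))) (S j)); lia. }
  assert (Hmono : forall i j, (i <= j)%nat -> (nu i <= nu j)%nat).
  { intros i j H. induction H; [lia|]. specialize (Hstep m). lia. }
  assert (Hinf : forall m, exists J, (m <= nu J)%nat).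
  { induction m as [|m [J HJ]]; [exists O; lia|].
    destruct (Nat.le_gt_cases (S m) (nu J)) as [H|H]; [exists J; exact H|].
    (* at time [max J (T (S m))] the sequence has value [m] or has already passed it *)
    set (k := max J (T (S m))). exists (S k).
    assert (nu J <= nu k)%nat by (apply Hmono; unfold k; lia).
    destruct (Nat.le_gt_cases (S m) (nu k)) as [H'|H'].
    - specialize (Hstep k). lia.
    - assert (Ek : nu k = m) by lia. simpl. rewrite Ek.
      destruct (Nat.leb_spec (T (S m)) (S k)) as [_|Hlt]; [lia|]. unfold k in Hlt. lia. }
  exists nu. intros m. destruct (Hinf (S m)) as [J HJ]. exists J. intros j Hj.
  specialize (Hmono J j Hj). split; [lia|]. destruct (Hinv j) as [H|H]; [lia|exact H].
Qed.

(** Arithmetic-geometric mean inequality: the linear term of [assoc_fun_upper] is dominated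
    by the quadratic one of [entire_term_growth]. *)
Lemma two_exp_le c E : 0 < c -> 2 * E <= / 4 * c * E ^ 2 + 4 / c.
Proof.
  intros Hc. pose proof (pow2_ge_0 (c * E - 4)).
  apply Rmult_le_reg_r with (4 * c); [lra|].
  replace ((/ 4 * c * E ^ 2 + 4 / c) * (4 * c)) with (c ^ 2 * E ^ 2 + 16) by (field; lra).
  nra.
Qed.

(** * Non-triviality of the Gelfand-Shilov spaces *)

(** The constant comes from [log_growth_of_assoc_fun] with [mu = PI / (2 h')], where [h'] is
    halfway between [|Im z0|] and [h]. *)
Lemma log_growth_necessary (M : nat -> R) (f : C -> C) (h lambda : R) (z0 : C) :
  (forall p, 0 < M p) ->
  is_lim_seq (fun p => M p / M (p - 1)%nat) p_infty ->
  0 < lambda -> strip h z0 -> f z0 <> 0 ->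
  (forall z, strip h z -> wiener_at f z) ->
  decay_bound M h lambda f ->
  bound (fun y => exists p, (2 <= p)%nat /\
    y = ln (INR p) ^ p / ((2 * (PI / (Rabs (Im z0) + h)) * exp 1 / lambda) ^ p * M p)).
Proof.
  intros HM Hlim Hl Hz Hfz Hf Hdec. unfold strip in Hz.
  pose proof (Rabs_pos (Im z0)). pose proof PI_RGT_0.
  set (h' := (Rabs (Im z0) + h) / 2).
  destruct (assoc_fun_exp_bound M f h h' lambda z0) as [K HK]; try assumption;
    [unfold h'; lra|unfold h'; lra|].
  replace (PI / (Rabs (Im z0) + h)) with (PI / (2 * h')) by (unfold h'; field; lra).
  apply log_growth_of_assoc_fun with K; try assumption.
  apply Rdiv_lt_0_compat; unfold h'; lra.
Qed.

(** With [lambda = 1 / (3 h)] the bound of [assoc_fun_upper] at [lambda x] is of the order of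
    [e^(x / 3)], the square root of the best term of [G]. The height 1/14 is the one
    allowed by [N_j = 1]. *)
Lemma log_growth_sufficient_Roumieu (M : nat -> R) h B :
  (forall p, 0 < M p) ->
  is_lim_seq (fun p => M p / M (p - 1)%nat) p_infty ->
  0 < h ->
  (forall p, (2 <= p)%nat -> ln (INR p) ^ p / (h ^ p * M p) <= B) ->
  nontrivial (GS_Roumieu M).
Proof.
  intros HM Hlim Hh HB.
  destruct (assoc_fun_upper M h B HM Hh HB) as (B' & HB' & Hup).
  set (N := fun _ : nat => 1).
  assert (HN : forall j, 1 <= N j) by (intros; unfold N; lra).
  destruct (entire_sum_ex N HN) as [G HG].
  exists (Pfun (strip (1 / 14)) (fun z => cexp (- G z))). split.
  - exists (1 / 14), (1 / (3 * h)). simpl.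
    assert (Hl : 0 < 1 / (3 * h)) by (apply Rdiv_lt_0_compat; lra).
    split; [lra|]. split; [exact Hl|]. split; [tauto|]. split.
    + apply wiener_at_analytic_on. intros z _.
      apply wiener_at_cexp, wiener_at_opp, (wiener_at_entire N HN G HG).
    + set (c := exp (-4)). assert (Hc : 0 < c) by apply exp_pos.
      apply (decay_bound_entire N HN G HG M (1 / 14) (1 / (3 * h)) 0 3 (B' + 4 / c));
        try assumption; [lra|intros; unfold N; lra|].
      intros x Hx.
      destruct (INR_unbounded x) as [n Hn].
      destruct (level_crossing (fun j => 3 * (INR (S j) * N j)) x 0 n) as (j & _ & Hj1 & Hj2).
      { unfold N. simpl. lra. }
      { rewrite S_INR. unfold N. simpl. pose proof (pos_INR n). lra. }
      exists j. split.
      { unfold N in Hj1. rewrite S_INR in Hj1. pose proof (pos_INR j). lra. }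
      pose proof (entire_term_growth N x j HN Hj1 Hj2) as Hg. fold c in Hg.
      specialize (Hup (1 / (3 * h) * x)).
      replace (h * (1 / (3 * h) * x)) with (x / (3 * N (S j))) in Hup
        by (unfold N; field; lra).
      pose proof (two_exp_le c (exp (x / (3 * N (S j)))) Hc).
      pose proof (pow2_ge_0 (exp (x / (3 * N (S j))))). nra.
  - exists 0. split; [|apply cexp_neq_0].
    simpl. unfold strip. simpl. rewrite Rabs_R0. lra.
Qed.

(** Apply [assoc_fun_upper] with [h = 1 / (3 q^2)], [q = n + 1]: at [t = q x] the exponent is
    [x / (3 q)], half the one on the right. The additive constant, which depends on
    [n], is absorbed for large [x]; the one that remains does not depend on [n]. *)
Lemma assoc_fun_threshold (M : nat -> R) c n :
  (forall p, 0 < M p) -> 0 < c ->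
  (forall h, 0 < h -> bound (fun y => exists p, (2 <= p)%nat /\
     y = ln (INR p) ^ p / (h ^ p * M p))) ->
  exists T : nat, forall x, INR T <= x ->
    assoc_fun M (INR (S n) * x) <= / 2 * (c * exp (x / (3 * INR (S n))) ^ 2) + 4 / c.
Proof.
  intros HM Hc Hlog. set (q := INR (S n)).
  assert (Hq : 0 < q) by (apply lt_0_INR; lia).
  set (h := 1 / (3 * q ^ 2)).
  assert (Hh : 0 < h).
  { apply Rdiv_lt_0_compat; [lra|]. pose proof (pow_lt q 2 Hq). lra. }
  destruct (Hlog h Hh) as [B HB].
  destruct (assoc_fun_upper M h B HM Hh) as (B' & HB' & Hup).
  { intros p Hp. apply HB. exists p. auto. }
  destruct (INR_unbounded (12 * q * B' / c)) as [T HT].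
  exists T. intros x Hx. specialize (Hup (q * x)).
  replace (h * (q * x)) with (x / (3 * q)) in Hup by (unfold h; field; lra).
  set (e := exp (x / (3 * q))) in *.
  assert (Hx0 : 0 <= x) by (pose proof (pos_INR T); lra).
  assert (He1 : 1 + x / (3 * q) <= e) by apply exp_ineq1_le.
  assert (Hxq : 4 * B' / c <= x / (3 * q)).
  { apply Rmult_le_reg_r with (3 * q); [lra|].
    replace (4 * B' / c * (3 * q)) with (12 * q * B' / c) by (field; lra).
    replace (x / (3 * q) * (3 * q)) with x by (field; lra). lra. }
  assert (HBc : 0 <= 4 * B' / c).
  { apply Rmult_le_pos; [lra|]. apply Rlt_le, Rinv_0_lt_compat, Hc. }
  assert (HB4 : B' <= / 4 * c * e ^ 2).
  { replace B' with (/ 4 * c * (4 * B' / c)) by (field; lra).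
    apply Rmult_le_compat_l; [lra|]. nra. }
  pose proof (two_exp_le c e Hc). lra.
Qed.

(** One sequence [N] serves all [h] and [lambda] at once: from some index on, [N_j] exceeds
    both [14 h] and [lambda]. *)
Lemma log_growth_sufficient_Beurling (M : nat -> R) :
  (forall p, 0 < M p) ->
  is_lim_seq (fun p => M p / M (p - 1)%nat) p_infty ->
  (forall h, 0 < h -> bound (fun y => exists p, (2 <= p)%nat /\
     y = ln (INR p) ^ p / (h ^ p * M p))) ->
  nontrivial (GS_Beurling M).
Proof.
  intros HM Hlim Hlog. set (c := exp (-4)). assert (Hc : 0 < c) by apply exp_pos.
  destruct (functional_choice _ (fun n => assoc_fun_threshold M c n HM Hc Hlog)) as [T HT].
  destruct (slow_sequence T) as [nu Hnu].
  set (N := fun j => INR (S (nu j))).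
  assert (HN : forall j, 1 <= N j).
  { intros j. unfold N. rewrite S_INR. pose proof (pos_INR (nu j)). lra. }
  destruct (entire_sum_ex N HN) as [G HG].
  exists (Pfun (fun _ => True) (fun z => cexp (- G z))). split.
  2: { exists 0. split; [exact I|apply cexp_neq_0]. }
  split; [simpl; tauto|]. split; simpl.
  { apply wiener_at_analytic_on. intros z _.
    apply wiener_at_cexp, wiener_at_opp, (wiener_at_entire N HN G HG). }
  intros h lambda Hh Hl.
  destruct (INR_unbounded (14 * h + lambda)) as [m Hm].
  destruct (Hnu m) as [J HJ].
  assert (HNJ : forall i, (J <= i)%nat -> 14 * h + lambda <= N i).
  { intros i Hi. unfold N. destruct (HJ i Hi) as [Hi' _].
    assert (INR m <= INR (S (nu i))) by (apply le_INR; lia). lra. }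
  apply (decay_bound_entire N HN G HG M h lambda J (3 * (INR (S J) * N J)) (4 / c));
    try assumption.
  { intros i Hi. specialize (HNJ i Hi). lra. }
  intros x Hx.
  destruct (INR_unbounded x) as [n Hn].
  destruct (level_crossing (fun j => 3 * (INR (S j) * N j)) x J n Hx) as (j & HJj & Hj1 & Hj2).
  { specialize (HN (J + n)%nat). rewrite S_INR, plus_INR.
    pose proof (pos_INR n). pose proof (pos_INR J). nra. }
  pose proof (HN j) as HNj. pose proof (pos_INR j) as Pj. pose proof (HNJ j HJj) as HNj'.
  exists j. split.
  { rewrite S_INR in Hj1. nra. }
  destruct (HJ (S j) ltac:(lia)) as [_ HTj].
  assert (HTx : INR (T (nu (S j))) <= x).
  { apply Rle_trans with (INR (S j)); [apply le_INR; exact HTj|].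
    pose proof (lt_0_INR (S j) ltac:(lia)). nra. }
  specialize (HT (nu (S j)) x HTx). fold (N (S j)) in HT.
  pose proof (entire_term_growth N x j HN Hj1 Hj2) as Hg. fold c in Hg.
  assert (Hx0 : 0 <= x) by (pose proof (pos_INR (T (nu (S j)))); lra).
  assert (assoc_fun M (lambda * x) <= assoc_fun M (N (S j) * x)).
  { apply assoc_fun_incr; [assumption|assumption|]. apply Rmult_le_compat_r; [exact Hx0|].
    specialize (HNJ (S j) ltac:(lia)). lra. }
  lra.
Qed.

Theorem mainTheorem1
  (M : nat -> R)
  (M_pos : forall p : nat, 0 < M p)
  (M_logconvex : forall p : nat, (1 <= p)%nat ->
     M p ^ 2 <= M (p - 1)%nat * M (p + 1)%nat)
  (M_lim : is_lim_seq (fun p : nat => M p / M (p - 1)%nat) p_infty) :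
  (nontrivial (GS_Beurling M) <->
     forall h : R, 0 < h ->
       bound (fun y : R => exists p : nat, (2 <= p)%nat /\
         y = ln (INR p) ^ p / (h ^ p * M p)))
  /\
  (nontrivial (GS_Roumieu M) <->
     exists h : R, 0 < h /\
       bound (fun y : R => exists p : nat, (2 <= p)%nat /\
         y = ln (INR p) ^ p / (h ^ p * M p))).
Proof.
  pose proof PI_RGT_0 as Hpi. pose proof (exp_pos 1) as He.
  split; split.
  - intros (f & (Hdom & Han & Hdec) & z0 & _ & Hfz) h Hh.
    pose proof (Rabs_pos (Im z0)) as Hy.
    (* Any strip around [z0] will do; [lambda] is then chosen to produce the given [h]. *)
    set (k := Rabs (Im z0) + 1).
    set (lambda := 2 * (PI / (Rabs (Im z0) + k)) * exp 1 / h).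
    assert (Hk : 0 < 2 * (PI / (Rabs (Im z0) + k)) * exp 1).
    { apply Rmult_lt_0_compat; [|exact He]. apply Rmult_lt_0_compat; [lra|].
      apply Rdiv_lt_0_compat; unfold k; lra. }
    assert (Hl : 0 < lambda) by (apply Rdiv_lt_0_compat; assumption).
    replace h with (2 * (PI / (Rabs (Im z0) + k)) * exp 1 / lambda)
      by (unfold lambda; field; repeat split; unfold k; lra).
    apply (log_growth_necessary M (val f) k lambda z0); try assumption.
    + unfold strip, k. lra.
    + intros z _. apply (analytic_on_wiener_at (dom f)); [exact Han|apply Hdom].
    + apply Hdec; [unfold k; lra|exact Hl].
  - intros Hlog. apply log_growth_sufficient_Beurling; assumption.
  - intros (f & (h & lambda & Hh & Hl & Hdom & Han & Hdec) & z0 & Hz0 & Hfz).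
    pose proof (Rabs_pos (Im z0)) as Hy.
    exists (2 * (PI / (Rabs (Im z0) + h)) * exp 1 / lambda). split.
    + apply Rdiv_lt_0_compat; [|exact Hl]. apply Rmult_lt_0_compat; [|exact He].
      apply Rmult_lt_0_compat; [lra|]. apply Rdiv_lt_0_compat; lra.
    + apply (log_growth_necessary M (val f) h lambda z0); try assumption.
      * apply Hdom, Hz0.
      * intros z Hz. apply (analytic_on_wiener_at (dom f)); [exact Han|apply Hdom, Hz].
  - intros (h & Hh & [B HB]).
    apply (log_growth_sufficient_Roumieu M h B); try assumption.
    intros p Hp. apply HB. exists p. auto.
Qed.
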